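(* Let $H=(V,E,w)$ be a directed hypergraph on $n$ vertices with hyperedge weights $w:E\to\mathbb{R}_+$ and vertex weights $\pi:V\to\mathbb{R}_+$. Then $$\lambda^{\Delta}_\pi(H)\lesssim\vec\phi_\pi(H)\lesssim\sqrt{\log n}\cdot\lambda^{\Delta}_\pi(H).$$
   Context: Each hyperedge is $e=(H_e,T_e)$ with $H_e,T_e\subseteq V$ (head and tail sets). For $S\subseteq V$, $\delta^+(S)=\{e\in E:T_e\cap S\ne\emptyset,\ H_e\cap\overline S\ne\emptyset\}$, $\vec\phi_\pi(S)=\frac{\min\{w(\delta^+(S)),w(\delta^+(\overline S))\}}{\min\{\pi(S),\pi(\overline S)\}}$, $\vec\phi_\pi(H)=\min_{\emptyset\ne S\subsetneq V}\vec\phi_\pi(S)$. Let $\mathcal F(H)$ be the set of $F:V\times V\to\mathbb{R}_{\ge0}$ for which there are $F_e:H_e\times T_e\to\mathbb{R}_{\ge0}$ ($e\in E$) with $F(i,j)=\sum_{e:i\in H_e,j\in T_e}F_e(i,j)$, $\sum_{i\in H_e,j\in T_e}F_e(i,j)\le w(e)$ for all $e$, and $\sum_{i\in V}F(i,j)=\sum_{k\in V}F(j,k)$ for all $j$. Define $\lambda^{\Delta}_\pi(H)$ as the minimum over $v_1,\dots,v_n\in\mathbb{R}^n$ with $\sum_i\pi(i)v_i=0$, $\sum_i\pi(i)\|v_i\|^2=1$, $\|v_i-v_j\|^2+\|v_j-v_k\|^2\ge\|v_i-v_k\|^2$ for all $i,j,k$, of $\max_{F\in\mathcal F(H)}\sum_{i<j}\frac12(F(i,j)+F(j,i))\|v_i-v_j\|^2$.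 $\lesssim$ hides an absolute constant. *)

(* Defs.v *)
From HB Require Import structures.
From mathcomp Require Import all_boot all_order all_algebra.
From mathcomp Require Import all_classical all_reals exp.
Set Implicit Arguments. Unset Strict Implicit. Unset Printing Implicit Defensive.
Import Order.TTheory GRing.Theory Num.Theory.
Local Open Scope ring_scope.


(* A directed hypergraph on vertex set 'I_n with hyperedge index type E:
   hyperedge e = (Hd e, Tl e) (head set, tail set), weight w e. *)
Section DirHyp.
Variables (R : realType) (n : nat) (E : finType).
Variables (Hd Tl : E -> {set 'I_n}) (w : E -> R) (pi : 'I_n -> R).

Definition piS (S : {set 'I_n}) : R := \sum_(i in S) pi i.

Definition wout (S : {set 'I_n}) : R :=
  \sum_(e : E | (Tl e :&: S != finset.set0) && (Hd e :&: ~: S != finset.set0)) w e.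

Definition dphiS (S : {set 'I_n}) : R :=
  Num.min (wout S) (wout (~: S)) / Num.min (piS S) (piS (~: S)).

Definition dphi : R :=
  inf [set x | exists S : {set 'I_n}, [/\ S != finset.set0, S != finset.setTfor 'I_n & x = dphiS S]]%classic.

Definition flow_feasible (F : 'I_n -> 'I_n -> R) : Prop :=
  exists Fe : E -> 'I_n -> 'I_n -> R,
    [/\ (forall e i j, i \in Hd e -> j \in Tl e -> 0 <= Fe e i j),
        (forall i j, F i j = \sum_(e : E | (i \in Hd e) && (j \in Tl e)) Fe e i j),
        (forall e, \sum_(i in Hd e) \sum_(j in Tl e) Fe e i j <= w e) &
        (forall j, \sum_(i < n) F i j = \sum_(k < n) F j k)].

(* vectors v_1..v_n in R^n, v i = coordinates of v_i *)
Definition sqdist (v : 'I_n -> 'I_n -> R) (i j : 'I_n) : R :=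
  \sum_(k < n) (v i k - v j k) ^+ 2.

Definition sqnorm (v : 'I_n -> 'I_n -> R) (i : 'I_n) : R :=
  \sum_(k < n) (v i k) ^+ 2.

Definition sdp_feasible (v : 'I_n -> 'I_n -> R) : Prop :=
  [/\ (forall k, \sum_(i < n) pi i * v i k = 0),
      \sum_(i < n) pi i * sqnorm v i = 1 &
      (forall i j k, sqdist v i j + sqdist v j k >= sqdist v i k)].

Definition sdp_obj (v : 'I_n -> 'I_n -> R) (F : 'I_n -> 'I_n -> R) : R :=
  \sum_(i < n) \sum_(j < n | (i < j)%N) 2^-1 * (F i j + F j i) * sqdist v i j.

Definition sdp_val (v : 'I_n -> 'I_n -> R) : R :=
  sup [set x | exists F, flow_feasible F /\ x = sdp_obj v F]%classic.

Definition lambdaDelta : R :=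
  inf [set x | exists v, sdp_feasible v /\ x = sdp_val v]%classic.

End DirHyp.

(* Main.v *)
Require Import Defs.
From HB Require Import structures.
From mathcomp Require Import all_boot all_order all_algebra.
From mathcomp Require Import all_classical all_reals exp.
From mathcomp Require Import sequences ring lra.
Import Order.TTheory GRing.Theory Num.Theory.
Local Open Scope ring_scope.

(* The upper bound on lambda embeds a cut S on a line. Conversely, fix a feasible v and
   put d(i,j) = |v_i - v_j|^2. Linear programming duality for the inner maximum yields q_e
   >= 0 and potentials r with d(i,j) + r_i - r_j <= q_e for i in H_e, j in T_e, and sum_e
   w(e) q_e at most twice the value of v. The positive part of d(i,j) + r_i - r_j is a
   directed semimetric. Given a set L of constant measure, split it at a median of r: each
   vertex j is at directed distance at least d(L,j) either from the upper half of L or to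
   the lower half, so a threshold cut of one of these two distance functions has ratio
   O(sum_e w(e) q_e / sum_j pi(j) d(L,j)).

   It remains to find L with average distance Omega(1/sqrt(log n)). Either a ball carries
   half of the measure and is such an L, or a constant fraction of the pairs are far apart
   and the Arora-Rao-Vazirani argument applies. The latter is carried out with random
   signs instead of Gaussians and with Rothvoss's potential: if no two large sets are
   Delta-separated, the projections have on average a large fractional matching along
   Delta-short pairs, so the expected maxima of the projections over balls of radius k Delta grow
   linearly in k, while they are O(sqrt(log n)) as long as k Delta = O(1). *)

(** * Expectations over random signs *)

Section SignExpectation.
Context {R : realType}.
Implicit Types (f g : seq R -> R) (a : nat -> R) (s : seq R).

(** The mean over [m] independent uniform signs, defined by conditioning on the first one; proofs
    then go by induction on [m], with no probability space. *)
Fixpoint signE (m : nat) f : R :=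
  if m is m'.+1 then
    (signE m' (fun s => f (1 :: s)) + signE m' (fun s => f (-1 :: s))) / 2
  else f [::].

(** Missing entries of [s] count as 0, so the identities below hold for lists of every length and no
    size hypothesis has to be carried along. *)
Definition dot (m : nat) a s : R := \sum_(k < m) a k * s`_k.

Lemma eq_signE m f g : f =1 g -> signE m f = signE m g.
Proof.
elim: m f g => [|m IH] f g fg /=; first exact: fg.
by congr ((_ + _) / 2); apply: IH => s.
Qed.

Lemma signE_le m f g : (forall s, f s <= g s) -> signE m f <= signE m g.
Proof.
elim: m f g => [|m IH] f g fg /=; first exact: fg.
by rewrite ler_pM2r ?invr_gt0// lerD// IH.
Qed.

Lemma signE_ge0 m f : (forall s, 0 <= f s) -> 0 <= signE m f.
Proof. by elim: m f => [|m IH] f f0 //=; rewrite divr_ge0// addr_ge0// IH. Qed.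

Lemma signE_cst m c : signE m (fun=> c) = c.
Proof. by elim: m => //= m ->; field. Qed.

Lemma signED m f g : signE m (fun s => f s + g s) = signE m f + signE m g.
Proof. by elim: m f g => //= m IH f g; rewrite !IH; field. Qed.

Lemma signEZ m c f : signE m (fun s => c * f s) = c * signE m f.
Proof. by elim: m f => //= m IH f; rewrite !IH; field. Qed.

Lemma signEN m f : signE m (fun s => - f s) = - signE m f.
Proof.
by rewrite -mulN1r -signEZ; apply: eq_signE => s; rewrite mulN1r.
Qed.

Lemma signEB m f g : signE m (fun s => f s - g s) = signE m f - signE m g.
Proof. by rewrite signED signEN. Qed.

Lemma signE_sum m (I : finType) (F : I -> seq R -> R) :
  signE m (fun s => \sum_i F i s) = \sum_i signE m (F i).
Proof.
elim: m F => //= m IH F.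
by rewrite !IH -big_split /= mulr_suml.
Qed.

Lemma signE_opp m f : signE m (fun s => f (map -%R s)) = signE m f.
Proof.
elim: m f => //= m IH f.
by rewrite (IH (fun s => f (-1 :: s))) (IH (fun s => f (- -1 :: s))) opprK addrC.
Qed.

Lemma dot_cons m a x s : dot m.+1 a (x :: s) = a 0%N * x + dot m (a \o S) s.
Proof. by rewrite /dot big_ord_recl. Qed.

Lemma dot_opp m a s : dot m a (map -%R s) = - dot m a s.
Proof.
rewrite /dot -sumrN; apply: eq_bigr => k _.
have [ks|ks] := ltnP k (size s); first by rewrite (nth_map 0)// mulrN.
by rewrite !nth_default ?size_map// mulr0 oppr0.
Qed.

Lemma dotB m a b s : dot m (fun k => a k - b k) s = dot m a s - dot m b s.
Proof. by rewrite /dot -sumrB; apply: eq_bigr => k _; rewrite mulrBl. Qed.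

Lemma signE_sqr_ge m f : signE m f ^+ 2 <= signE m (fun s => f s ^+ 2).
Proof.
rewrite -subr_ge0.
suff -> : signE m (fun s => f s ^+ 2) - signE m f ^+ 2 =
          signE m (fun s => (f s - signE m f) ^+ 2).
  by apply: signE_ge0 => s; exact: sqr_ge0.
set c := signE m f.
rewrite (_ : signE m (fun s => (f s - c) ^+ 2) =
   signE m (fun s => f s ^+ 2 + ((- 2 * c) * f s + c ^+ 2))); last first.
  by apply: eq_signE => s; ring.
by rewrite !signED signEZ signE_cst -/c; ring.
Qed.

(* An Efron-Stein argument: [A s] is a subgradient of the convex function [f] at [s]. *)
Lemma signE_variance_convex m f (A : seq R -> nat -> R) :
  (forall s s', f s + dot m (A s) s' - dot m (A s) s <= f s') ->
  signE m (fun s => f s ^+ 2) - signE m f ^+ 2 <=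
    2 * signE m (fun s => \sum_(k < m) A s k ^+ 2).
Proof.
elim: m f A => [|m IH] f A fA /=; first by rewrite big_ord0 subrr mulr0.
have hp e : forall s s', f (e :: s) + dot m (A (e :: s) \o S) s'
     - dot m (A (e :: s) \o S) s <= f (e :: s').
  by move=> s s'; have := fA (e :: s) (e :: s'); rewrite !dot_cons; lra.
have := IH _ (fun s => A (1 :: s) \o S) (hp 1).
have := IH _ (fun s => A (-1 :: s) \o S) (hp (-1)).
rewrite (eq_signE m (fun s => \sum_(k < m.+1) A (1 :: s) k ^+ 2)
  (fun s => A (1 :: s) 0%N ^+ 2 + \sum_(k < m) A (1 :: s) k.+1 ^+ 2)); last first.
  by move=> s; rewrite big_ord_recl.
rewrite (eq_signE m (fun s => \sum_(k < m.+1) A (-1 :: s) k ^+ 2)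
  (fun s => A (-1 :: s) 0%N ^+ 2 + \sum_(k < m) A (-1 :: s) k.+1 ^+ 2)); last first.
  by move=> s; rewrite big_ord_recl.
rewrite !signED /=.
set Fp := signE m (fun s => f (1 :: s)); set Fn := signE m (fun s => f (-1 :: s)).
set S1 := signE m (fun s => \sum_(_ < _) _).
set S2 := signE m (fun s => \sum_(_ < _) _).
set Q1 := signE m (fun s => _ ^+ 2); set Q2 := signE m (fun s => _ ^+ 2).
set Q3 := signE m (fun s => _ ^+ 2); set Q4 := signE m (fun s => _ ^+ 2).
(* By the law of total variance only the difference of the two conditional means is left. For each
   [s], the subgradients at both ends confine the jump of [f] between [2 * b] and [2 * a]. *)
have : (Fp - Fn) ^+ 2 <= 4 * Q3 + 4 * Q4.
  rewrite -signEB; apply: le_trans (signE_sqr_ge _ _) _.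
  rewrite -!signEZ -signED; apply: signE_le => s.
  have h1 := fA (1 :: s) (-1 :: s); have h2 := fA (-1 :: s) (1 :: s).
  rewrite !dot_cons in h1 h2.
  set x := f _ - f _; set a := A (1 :: s) 0%N; set b := A (-1 :: s) 0%N.
  have x1 : x <= 2 * a by rewrite /x /a; lra.
  have x2 : 2 * b <= x by rewrite /x /b; lra.
  have [x0|x0] := leP 0 x; nra.
nra.
Qed.

Lemma signE_dot_sqr m a : signE m (fun s => dot m a s ^+ 2) = \sum_(k < m) a k ^+ 2.
Proof.
(* The shift [c] is there for the induction: it absorbs the first coordinate. *)
suff H c : signE m (fun s => (c + dot m a s) ^+ 2) = c ^+ 2 + \sum_(k < m) a k ^+ 2.
  have := H 0; rewrite expr0n /= add0r => <-.
  by apply: eq_signE => s; rewrite add0r.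
elim: m a c => [|m IH] a c /=; first by rewrite /dot !big_ord0 !addr0.
under eq_signE do rewrite dot_cons addrA.
under [X in (_ + X) / 2]eq_signE do rewrite dot_cons addrA.
by rewrite !IH big_ord_recl /=; field.
Qed.

Lemma signE_dot_pow4 m a :
  signE m (fun s => dot m a s ^+ 4) <= 3 * (\sum_(k < m) a k ^+ 2) ^+ 2.
Proof.
elim: m a => [|m IH] a /=; first by rewrite /dot !big_ord0; lra.
rewrite -signED.
rewrite (eq_signE m _ (fun s => 2 * dot m (a \o S) s ^+ 4 +
  ((12 * a 0%N ^+ 2) * dot m (a \o S) s ^+ 2 + 2 * a 0%N ^+ 4))); last first.
  by move=> s; rewrite !dot_cons; ring.
rewrite !signED !signEZ signE_cst signE_dot_sqr big_ord_recl /=.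
have := IH (a \o S); set T := \sum_(_ < _) _ => hT.
have := sqr_ge0 (a 0%N ^+ 2).
rewrite -exprM /= => h.
have -> : 3 * (a 0%N ^+ 2 + T) ^+ 2 = 3 * a 0%N ^+ 4 + 6 * a 0%N ^+2 * T + 3 * T ^+ 2 by ring.
by lra.
Qed.

(** The constant 2 in place of the sharp 1/2 keeps this elementary: for [x > 1 / 2] one has
    [x <= 2 * x ^+ 2], and for small [x] the linear terms of [1 + y + 2 * y ^+ 2] at [x] and [- x]
    cancel. *)
Lemma cosh_le (x : R) : (expR x + expR (- x)) / 2 <= expR (2 * x ^+ 2).
Proof.
wlog x0 : x / 0 <= x.
  move=> H; have [|x0] := leP 0 x; first exact: H.
  by have := H (- x); rewrite sqrrN opprK addrC; apply; lra.
have [xh|xh] := leP x (1 / 2); last first.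
  have h1 : expR (- x) <= expR x by rewrite ler_expR; lra.
  have h2 : expR x <= expR (2 * x ^+ 2) by rewrite ler_expR; nra.
  lra.
have bnd (y : R) : - (1/2) <= y -> y <= 1 / 2 -> expR y <= 1 + y + 2 * y ^+ 2.
  move=> y1 y2.
  have h1 := expR_ge1Dx (- y).
  have h2 := expR_gt0 y.
  have h3 := expRxMexpNx_1 y.
  have h4 : expR y * (1 - y) <= expR y * expR (- y) by rewrite ler_pM2l.
  have h5 : 1 <= (1 + y + 2 * y ^+ 2) * (1 - y).
    have : 0 <= y ^+ 2 * (1 - 2 * y) by apply: mulr_ge0; [exact: sqr_ge0|lra].
    by nra.
  have y3 : 0 < 1 - y by lra.
  by rewrite -(ler_pM2r y3); rewrite h3 in h4; lra.
have h1 := bnd x; have h2 := bnd (- x); have := expR_ge1Dx (2 * x ^+ 2).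
rewrite sqrrN in h2.
have := h1 ltac:(lra) ltac:(lra); have := h2 ltac:(lra) ltac:(lra).
lra.
Qed.

Lemma signE_expR_dot m a c :
  signE m (fun s => expR (c * dot m a s)) <=
    expR (2 * c ^+ 2 * \sum_(k < m) a k ^+ 2).
Proof.
elim: m a => [|m IH] a /=; first by rewrite /dot !big_ord0 !mulr0.
have E e : signE m (fun s => expR (c * dot m.+1 a (e :: s))) =
    expR (c * a 0%N * e) * signE m (fun s => expR (c * dot m (a \o S) s)).
  rewrite -signEZ; apply: eq_signE => s; rewrite dot_cons -expRD; congr expR; ring.
rewrite (E 1) (E (-1)) big_ord_recl.
have h1 := IH (a \o S).
have h2 := cosh_le (c * a 0%N).
rewrite mulr1 mulrN1 -mulrDl mulrAC.
rewrite (_ : 2 * _ * _ = 2 * (c * a 0%N) ^+ 2 +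
  2 * c ^+ 2 * \sum_(k < m) a k.+1 ^+ 2); last by rewrite /bump /=; ring.
rewrite expRD.
apply: ler_pM => //; first by rewrite divr_ge0// addr_ge0// expR_ge0.
by apply: signE_ge0 => s; exact: expR_ge0.
Qed.

(* Pointwise, 1_{y >= 1/4} >= (y - 1/4) (25/4 - y) / 9 at y = X^2 / |a|^2. *)
Lemma signE_dot_anticoncentration m a (t : R) : 0 < t ->
  t <= \sum_(k < m) a k ^+ 2 ->
  1 / 5 <= signE m (fun s => (t / 4 <= dot m a s ^+ 2)%R%:R).
Proof.
move=> t0; set A := \sum_(_ < _) _ => tA.
have A0 : 0 < A by lra.
have h4 := signE_dot_pow4 m a; rewrite -/A in h4.
have h2 := signE_dot_sqr m a; rewrite -/A in h2.
have Ai : A * A^-1 = 1 by rewrite divff// gt_eqF.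
have Ai0 : 0 < A^-1 by rewrite invr_gt0.
set c := A^-1 in Ai Ai0.
have : signE m (fun s => (13 / 18 * c) * dot m a s ^+ 2 +
    ((- (1 / 9) * c ^+ 2) * dot m a s ^+ 4 - 25 / 144)) <=
    signE m (fun s => (t / 4 <= dot m a s ^+ 2)%R%:R).
  apply: signE_le => s; set y := dot m a s ^+ 2.
  rewrite (_ : dot m a s ^+ 4 = y ^+ 2); last by rewrite /y -exprM.
  have y0 : 0 <= y by exact: sqr_ge0.
  rewrite (_ : _ + _ = (c * y - 1 / 4) * (25 / 4 - c * y) / 9); last by field.
  have [ty|ty] := leP (t / 4) y.
    by rewrite mulr1n; have := sqr_ge0 (c * y - 13 / 4); nra.
  have h : c * y < 1 / 4.
    have : c * y < c * (A / 4) by rewrite ltr_pM2l//; lra.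
    by rewrite (_ : c * (A / 4) = 1 / 4)//; rewrite mulrA [c * A]mulrC Ai.
  have : 0 <= (1 / 4 - c * y) * (25 / 4 - c * y) by apply: mulr_ge0; lra.
  by rewrite mulr0n; lra.
rewrite !signED !signEZ signE_cst h2 => h.
have : c ^+ 2 * signE m (fun s => dot m a s ^+ 4) <= 3.
  apply: le_trans (_ : c ^+ 2 * (3 * A ^+ 2) <= 3).
    by rewrite ler_wpM2l// sqr_ge0.
  by rewrite mulrCA -exprMn mulrC [c * A]mulrC Ai expr1n mul1r.
nra.
Qed.

End SignExpectation.

(** * Farkas lemma, weighted medians and fractional matchings *)

Section Farkas.
Context {R : realType}.

Lemma exists_between (I J : finType) (P : pred I) (Q : pred J) (l : I -> R) (u : J -> R) :
  (forall i j, P i -> Q j -> l i <= u j) ->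
  exists t, (forall i, P i -> l i <= t) /\ (forall j, Q j -> t <= u j).
Proof.
move=> lu; have [i0 Pi0|P0] := pickP P.
  case: (arg_maxP l Pi0) => i Pi hi; exists (l i); split=> [k Pk|j Qj]; first exact: hi.
  exact: lu.
have [j0 Qj0|Q0] := pickP Q; last by exists 0; split=> k; rewrite ?P0 ?Q0.
case: (arg_minP u Qj0) => j Qj hj; exists (u j); split=> [i|k Qk]; first by rewrite P0.
exact: hj.
Qed.

(* Fourier-Motzkin: eliminating the variable [k] replaces the constraints by the
   nonnegative combinations [W] of them in which [k] does not occur. *)
Lemma farkas (K : eqType) (l : seq K) (I : finType) (a : I -> K -> R) (b : I -> R) :
  uniq l ->
  (exists x : K -> R, forall i, \sum_(k <- l) a i k * x k <= b i) \/
  (exists y : I -> R, [/\ forall i, 0 <= y i,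
     forall k, k \in l -> \sum_i y i * a i k = 0 & \sum_i y i * b i < 0]).
Proof.
elim: l I a b => [|k l IH] I a b /=.
  move=> _; have [i bi|b0] := pickP (fun i => b i < 0).
    right; exists (fun j => (j == i)%:R); split=> [j|//|]; first by rewrite ler0n.
    rewrite (bigD1 i)//= eqxx mul1r big1 ?addr0// => j /negbTE ->; exact: mul0r.
  by left; exists (fun=> 0) => i; rewrite big_nil leNgt b0.
case/andP => kl ul.
(* [inl] keeps a row free of [k]; [inr] combines a positive and a negative coefficient of [k] so
   that they cancel. All other indices give the trivial row 0 <= 0. *)
pose J : finType := (I + I * I)%type.
pose W (j : J) (i : I) : R := match j with
  | inl i1 => if a i1 k == 0 then (i == i1)%:R else 0
  | inr (i1, i2) => if (0 < a i1 k) && (a i2 k < 0)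
      then (i == i1)%:R * - a i2 k + (i == i2)%:R * a i1 k else 0 end.
have pick1 (F : I -> R) i1 : \sum_i (i == i1)%:R * F i = F i1.
  rewrite (bigD1 i1)//= eqxx mul1r big1 ?addr0// => j /negbTE ->; exact: mul0r.
have pick2 (F : I -> R) i1 i2 c1 c2 :
    \sum_i ((i == i1)%:R * c1 + (i == i2)%:R * c2) * F i = c1 * F i1 + c2 * F i2.
  rewrite -(pick1 (fun i => c1 * F i)) -(pick1 (fun i => c2 * F i)) -big_split /=.
  by apply: eq_bigr => i _; ring.
have W0 j i : 0 <= W j i.
  case: j => [i1|[i1 i2]] /=; first by case: ifP; rewrite ?ler0n.
  case: ifP => // /andP[h1 h2]; rewrite addr_ge0// mulr_ge0 ?ler0n//; lra.
have Wk j : \sum_i W j i * a i k = 0.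
  case: j => [i1|[i1 i2]] /=.
    have [h|_] := eqVneq; first by rewrite pick1.
    by apply: big1 => i _; rewrite mul0r.
  case: (_ && _); first by rewrite pick2; ring.
  by apply: big1 => i _; rewrite mul0r.
have [[x hx]|[y [y0 yl yb]]] := IH J (fun j k => \sum_i W j i * a i k)
   (fun j => \sum_i W j i * b i) ul; last first.
  right; exists (fun i => \sum_j y j * W j i).
  have ex (F : I -> R) : \sum_i (\sum_j y j * W j i) * F i = \sum_j y j * \sum_i W j i * F i.
    under eq_bigr do rewrite mulr_suml; rewrite exchange_big /=.
    by apply: eq_bigr => j _; rewrite mulr_sumr; apply: eq_bigr => i _; rewrite mulrA.
  split=> [i|k'|]; first by apply: sumr_ge0 => j _; rewrite mulr_ge0.
    rewrite inE ex => /orP[/eqP->|k'l]; last exact: yl.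
    by apply: big1 => j _; rewrite Wk mulr0.
  by rewrite ex.
left.
pose r i := b i - \sum_(k <- l) a i k * x k.
have hr j : 0 <= \sum_i W j i * r i.
  have := hx j; rewrite -subr_ge0.
  congr (_ <= _).
  under [in RHS]eq_bigr do rewrite /r mulrBr.
  rewrite sumrB; congr (_ - _).
  under eq_bigr do rewrite mulr_suml.
  rewrite exchange_big /=; apply: eq_bigr => i _; rewrite mulr_sumr.
  by apply: eq_bigr => k' _; rewrite mulrA.
have [t [ht1 ht2]] : exists t, (forall i, a i k < 0 -> r i / a i k <= t) /\
    (forall i, 0 < a i k -> t <= r i / a i k).
  (* The combined row of [j] and [i] says exactly that this lower bound on the eliminated variable
     is below this upper bound. *)
  apply: exists_between => i j hi hj.
  have := hr (inr (j, i)); rewrite /= hi hj /= pick2 => h.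
  by rewrite ler_pdivlMr// mulrAC ler_ndivrMr//; lra.
exists (fun k' => if k' == k then t else x k') => i.
rewrite big_cons eqxx.
rewrite (_ : \sum_(j <- l) _ = b i - r i); last first.
  rewrite /r opprB addrC subrK; apply: eq_big_seq => k' k'l.
  by case: eqP => // E; rewrite -E k'l in kl.
suff : a i k * t <= r i by lra.
have [h|h|h] := ltgtP (a i k) 0.
- by have := ht1 i h; rewrite ler_ndivrMr// mulrC.
- by have := ht2 i h; rewrite ler_pdivlMr// mulrC.
by have := hr (inl i); rewrite /= h eqxx pick1 mul0r.
Qed.

End Farkas.

Section Weights.
Context {R : realType} {V : finType}.
Implicit Types (p f : V -> R).

(** The median is the largest value [f i] for which the part of [L] above it, itself included, still
    has half of the weight. The part strictly above starts at the next value, so it has at most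
    half. *)
Lemma weighted_median p f (L : {set V}) : (forall i, 0 <= p i) -> L != finset.set0 ->
  exists m, (\sum_(i in L) p i) / 2 <= \sum_(i in L | m <= f i) p i /\
            (\sum_(i in L) p i) / 2 <= \sum_(i in L | f i <= m) p i.
Proof.
move=> p0 /set0Pn[i0 i0L].
set P := \sum_(i in L) p i.
have P0 : 0 <= P by apply: sumr_ge0.
pose ok i := (i \in L) && (P / 2 <= \sum_(k in L | f i <= f k) p k).
have [i1 ok1] : exists i, ok i.
  case: (arg_minP f i0L) => i iL hi; exists i; rewrite /ok (iL : i \in L) /=.
  rewrite [X in _ <= X](_ : _ = P) ?ler_pdivrMr//; first by lra.
  by apply: eq_bigl => k; have [kL|//] := boolP (k \in L); rewrite hi.
case: (arg_maxP f ok1) => i /andP[iL hi] imax; exists (f i); split=> //.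
have : \sum_(k in L | f i < f k) p k <= P / 2.
  have [k /andP[kL ik]|none] := pickP (fun k => (k \in L) && (f i < f k)); last first.
    by rewrite big_pred0// divr_ge0.
  have kP : (k \in L) && (f i < f k) by rewrite kL.
  case: (@arg_minP _ _ _ k (fun k => (k \in L) && (f i < f k)) f kP) => j /andP[jL ij] jmin.
  rewrite (eq_bigl (fun k => (k \in L) && (f j <= f k))); last first.
    move=> k'; have [k'L|//] := boolP (k' \in L) => /=.
    apply/idP/idP => h; first by apply: jmin; rewrite k'L.
    exact: lt_le_trans ij h.
  rewrite leNgt; apply/negP => /ltW hj.
  have : f j <= f i by apply: imax; rewrite /ok jL.
  by rewrite leNgt ij.
have : P = \sum_(k in L | f i < f k) p k + \sum_(k in L | f k <= f i) p k.
  rewrite /P (bigID (fun k => f i < f k)) /=; congr (_ + _).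
  by apply: eq_bigl => k; rewrite -leNgt.
lra.
Qed.

(** Greedy construction: the pairs are visited one by one and each is raised as far as both residual
    capacities allow. Row and column sums only grow, so a saturated vertex stays saturated. Rows and
    columns have separate capacities, as in a bipartite graph on two copies of [V]. *)
Lemma maximal_fractional_matching p (E : V -> V -> bool) : (forall i, 0 <= p i) ->
  exists M : V -> V -> R,
    [/\ forall u w, 0 <= M u w, forall u w, ~~ E u w -> M u w = 0,
        forall u, \sum_w M u w <= p u, forall w, \sum_u M u w <= p w &
        forall u w, E u w -> \sum_z M u z = p u \/ \sum_z M z w = p w].
Proof.
move=> p0.
suff [M [h1 h2 h3 h4 h5]] : exists M : V -> V -> R,
    [/\ forall u w, 0 <= M u w, forall u w, ~~ E u w -> M u w = 0,
        forall u, \sum_w M u w <= p u, forall w, \sum_u M u w <= p w &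
        forall u w, (u, w) \in index_enum (V * V)%type -> E u w ->
          \sum_z M u z = p u \/ \sum_z M z w = p w].
  by exists M; split=> // u w; apply: h5; exact: mem_index_enum.
elim: (index_enum (V * V)%type) => [|[u0 w0] l [M [M0 ME Mu Mw Ml]]].
  by exists (fun _ _ => 0); split=> // u; rewrite big1.
have [Euw|Euw] := boolP (E u0 w0); last first.
  exists M; split=> // u w; rewrite inE => /orP[/eqP[-> ->]|]; last exact: Ml.
  by rewrite (negbTE Euw).
pose t := Num.min (p u0 - \sum_w M u0 w) (p w0 - \sum_u M u w0).
have t0 : 0 <= t by rewrite /t le_min !subr_ge0 Mu Mw.
have t1 : t <= p u0 - \sum_w M u0 w by rewrite /t ge_min lexx.
have t2 : t <= p w0 - \sum_u M u w0 by rewrite /t ge_min lexx orbT.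
pose M' u w := M u w + (if (u == u0) && (w == w0) then t else 0).
have Su u : \sum_w M' u w = \sum_w M u w + (if u == u0 then t else 0).
  rewrite big_split /=; congr (_ + _); case: eqP => /= _; last by rewrite big1.
  by rewrite -big_mkcond /= big_pred1_eq.
have Sw w : \sum_u M' u w = \sum_u M u w + (if w == w0 then t else 0).
  rewrite big_split /=; congr (_ + _); case: (w == w0).
    under eq_bigr do rewrite andbT.
    by rewrite -big_mkcond /= big_pred1_eq.
  by rewrite big1// => u; rewrite andbF.
exists M'; split.
- by move=> u w; rewrite /M' addr_ge0//; case: ifP.
- move=> u w uw; rewrite /M' ME// add0r; case: ifP => // /andP[/eqP eu /eqP ew].
  by rewrite eu ew Euw in uw.
- by move=> u; rewrite Su; case: eqP => [->|_]; [lra|rewrite addr0].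
- by move=> w; rewrite Sw; case: eqP => [->|_]; [lra|rewrite addr0].
move=> u w; rewrite inE => /orP[/eqP[-> ->] _|uwl Exy].
  rewrite Su Sw !eqxx /t minElt; case: ifP => _; [left|right]; by rewrite addrC subrK.
have [h|h] := Ml _ _ uwl Exy; [left|right].
  apply/eqP; rewrite eq_le Su h; apply/andP; split; last by rewrite lerDl; case: ifP.
  by case: eqP => [eu|_]; rewrite ?addr0 // eu in h *; lra.
apply/eqP; rewrite eq_le Sw h; apply/andP; split; last by rewrite lerDl; case: ifP.
by case: eqP => [ew|_]; rewrite ?addr0 // ew in h *; lra.
Qed.

End Weights.

(** * Separated sets in metrics of negative type *)

Section Chaining.
Context {R : realType} {V : finType}.
Variables (m : nat) (v : V -> nat -> R).

Definition sqd (u w : V) : R := \sum_(k < m) (v u k - v w k) ^+ 2.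

Lemma sqdC u w : sqd u w = sqd w u.
Proof. by apply: eq_bigr => k _; rewrite -sqrrN opprB. Qed.

Lemma sqdxx u : sqd u u = 0.
Proof. by apply: big1 => k _; rewrite subrr expr0n. Qed.

Lemma sqd_ge0 u w : 0 <= sqd u w.
Proof. by apply: sumr_ge0 => k _; exact: sqr_ge0. Qed.

Definition ball_argmax (t : R) (u : V) (s : seq R) : V :=
  [arg max_(w > u | sqd u w <= t) dot m (v w) s]%O.

Definition ball_max (t : R) (u : V) (s : seq R) : R :=
  dot m (v (ball_argmax t u s)) s - dot m (v u) s.

Section BallMax.
Variable t : R.
Hypothesis t0 : 0 <= t.

Lemma ball_argmax_le u s : sqd u (ball_argmax t u s) <= t.
Proof. by rewrite /ball_argmax; case: arg_maxP => //; rewrite sqdxx. Qed.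

Lemma ball_max_ge u s w : sqd u w <= t -> dot m (v w) s - dot m (v u) s <= ball_max t u s.
Proof.
move=> uw; rewrite /ball_max lerB// /ball_argmax.
by case: arg_maxP => [|i _ hi]; [rewrite sqdxx|exact: hi].
Qed.

Lemma ball_max_ge0 u s : 0 <= ball_max t u s.
Proof. by rewrite -(subrr (dot m (v u) s)) ball_max_ge// sqdxx. Qed.

(** A maximum of linear forms is convex in the signs, and [v (ball_argmax t u s) - v u] is a
    subgradient at [s], of squared length at most [t]. *)
Lemma ball_max_variance u :
  signE m (fun s => ball_max t u s ^+ 2) - signE m (ball_max t u) ^+ 2 <= 2 * t.
Proof.
apply: le_trans (signE_variance_convex m (ball_max t u)
  (fun s k => v (ball_argmax t u s) k - v u k) _) _.
  move=> s s'; rewrite !dotB -/(ball_max t u s) [ball_max t u s + _ - _]addrAC subrr add0r.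
  exact/ball_max_ge/ball_argmax_le.
rewrite ler_pM2l// -[leRHS](signE_cst m); apply: signE_le => s.
by rewrite -[leLHS]/(sqd _ _) sqdC ball_argmax_le.
Qed.

(** The variance is at most [tau ^+ 2]; averaging [2 * tau * |x| <= x ^+ 2 + tau ^+ 2] turns this
    into a bound on the mean absolute deviation. *)
Lemma ball_max_deviation u (tau : R) : 0 < tau -> 2 * t <= tau ^+ 2 ->
  signE m (fun s => `|ball_max t u s - signE m (ball_max t u)|) <= tau.
Proof.
move=> tau0 ht; set f := ball_max t u; set c := signE m f.
have hv := ball_max_variance u; rewrite -/f -/c in hv.
rewrite -(ler_pM2l tau0) -signEZ.
apply: le_trans (_ : signE m (fun s => 1 / 2 * f s ^+ 2 +
   (- c * f s + (c ^+ 2 + tau ^+ 2) / 2)) <= _).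
  apply: signE_le => s; have := sqr_ge0 (`|f s - c| - tau).
  by rewrite sqrrB -normrX ger0_norm ?sqr_ge0//; nra.
rewrite !signED !signEZ signE_cst -/c.
nra.
Qed.

(* Maximal inequality: with [x = l Y - ln n - 2 l^2 t], combine [1 + x <= e^x] with the
   union bound [e^(l Y) <= \sum_w e^(l X_w)]. *)
Lemma ball_max_expectation u : (2 <= #|V|)%N ->
  signE m (ball_max t u) <= Num.sqrt (ln #|V|%:R) * (1 + 2 * t).
Proof.
(* This [l] balances the two terms: the resulting bound [(ln n + 2 * l ^+ 2 * t) / l] is
   [l * (1 + 2 * t)]. *)
move=> n2; set n : R := #|V|%:R; set l := Num.sqrt (ln n).
have n1 : 1 < n by rewrite ltr1n.
have l0 : 0 < l by rewrite sqrtr_gt0 ln_gt0.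
have ll : l ^+ 2 = ln n by rewrite sqr_sqrtr// ltW// ln_gt0.
have en : expR (ln n) = n by rewrite lnK// posrE; lra.
rewrite -(ler_pM2l l0) -signEZ.
pose c := expR (- (ln n + 2 * l ^+ 2 * t)).
pose X w s := expR (l * dot m (fun k => v w k - v u k) s).
apply: le_trans (_ : signE m (fun s => (ln n + 2 * l ^+ 2 * t - 1) +
   \sum_(w | sqd u w <= t) c * X w s) <= _).
  apply: signE_le => s.
  have := expR_ge1Dx (l * ball_max t u s - (ln n + 2 * l ^+ 2 * t)).
  suff : expR (l * ball_max t u s - (ln n + 2 * l ^+ 2 * t)) <=
     \sum_(w | sqd u w <= t) c * X w s by lra.
  rewrite expRD mulrC (bigD1 (ball_argmax t u s)) ?ball_argmax_le//=.
  rewrite /X dotB lerDl; apply: sumr_ge0 => w _; by rewrite mulr_ge0// expR_ge0.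
rewrite signED signE_cst.
under eq_signE do rewrite big_mkcond.
rewrite signE_sum /=.
have : \sum_(w : V) signE m (fun s => if sqd u w <= t then c * X w s else 0) <= \sum_(w : V) n^-1.
  apply: ler_sum => w _; case: (boolP (sqd u w <= t)) => [uw|_]; last first.
    by rewrite signE_cst invr_ge0; lra.
  rewrite signEZ.
  apply: le_trans (_ : c * expR (2 * l ^+ 2 * t) <= _).
    rewrite ler_wpM2l ?expR_ge0//; apply: le_trans (signE_expR_dot _ _ _) _.
    rewrite ler_expR ler_wpM2l//; first by rewrite mulr_ge0// sqr_ge0.
    by rewrite -[leLHS]/(sqd _ _) sqdC.
  by rewrite /c -expRD opprD subrK expRN en.
rewrite sumr_const -[n^-1 *+ _]mulr_natl divff; last by rewrite gt_eqF//; lra.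
rewrite -ll; lra.
Qed.

End BallMax.

Variable p : V -> R.
Hypothesis p0 : forall u, 0 <= p u.
Hypothesis p1 : \sum_u p u = 1.
Hypothesis tri : forall u w z, sqd u z <= sqd u w + sqd w z.

(* Following a matched pair [u -> w] raises the best projection reachable from [u], so the
   expected maxima over balls of radius [k Delta] grow linearly in [k] as long as their
   deviations are below [tau]. *)
Lemma chaining_step (M : seq R -> V -> V -> R) (D sigma tau t : R) :
  0 < tau -> 0 <= D -> 0 <= t -> 2 * (t + D) <= tau ^+ 2 ->
  (forall s u w, 0 <= M s u w) ->
  (forall s u w, M s u w != 0 -> sqd u w <= D /\ sigma <= dot m (v w) s - dot m (v u) s) ->
  (forall s u, \sum_w M s u w <= p u) -> (forall s w, \sum_u M s u w <= p w) ->
  (forall u, signE m (fun s => \sum_w M s u w) = signE m (fun s => \sum_w M s w u)) ->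
  sigma * signE m (fun s => \sum_u \sum_w M s u w) - 2 * tau +
    \sum_u signE m (fun s => \sum_w M s u w) * signE m (ball_max t u) <=
  \sum_u signE m (fun s => \sum_w M s u w) * signE m (ball_max (t + D) u).
Proof.
move=> tau0 D0 t0 ht M0 MD Mout Min Msym.
have tD0 : 0 <= t + D by rewrite addr_ge0.
pose f u := signE m (ball_max t u); pose f' u := signE m (ball_max (t + D) u).
(* For a matched pair, the best point of the [t]-ball of [w] lies in the [(t + D)]-ball of [u], and
   its projection gains [sigma] more over [u] than over [w]. The maxima are then replaced by their
   means; since the matched mass at [u] is at most [p u], this costs [p u] times the deviations. *)
have pointwise s : sigma * (\sum_u \sum_w M s u w) <=
   \sum_u (f' u * (\sum_w M s u w) + - f u * (\sum_w M s w u) +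
    (p u * `|ball_max (t + D) u s - f' u| + p u * `|ball_max t u s - f u|)).
  apply: le_trans (_ : \sum_u (\sum_w M s u w) * ball_max (t + D) u s -
     \sum_u (\sum_w M s w u) * ball_max t u s <= _); last first.
    rewrite -sumrB; apply: ler_sum => u _.
    have a0 : 0 <= \sum_w M s u w by apply: sumr_ge0.
    have b0 : 0 <= \sum_w M s w u by apply: sumr_ge0.
    have a1 := Mout s u; have b1 := Min s u.
    set a := \sum_w M s u w in a0 a1 *; set b := \sum_w M s w u in b0 b1 *.
    set y := ball_max (t + D) u s; set x := ball_max t u s.
    have h1 : a * (y - f' u) <= p u * `|y - f' u|.
      by apply: le_trans (ler_wpM2l a0 (ler_norm _)) _; rewrite ler_wpM2r.
    have h2 : b * (f u - x) <= p u * `|x - f u|.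
      rewrite distrC; by apply: le_trans (ler_wpM2l b0 (ler_norm _)) _; rewrite ler_wpM2r.
    by clearbody x y; lra.
  under [X in _ <= X - _]eq_bigr do rewrite mulr_suml.
  under [X in _ <= _ - X]eq_bigr do rewrite mulr_suml.
  rewrite [X in _ <= _ - X]exchange_big -sumrB mulr_sumr; apply: ler_sum => u _.
  rewrite -sumrB mulr_sumr; apply: ler_sum => w _ /=.
  have [->|Muw] := eqVneq (M s u w) 0; first by rewrite !mul0r mulr0 subrr.
  have [uw hs] := MD _ _ _ Muw.
  rewrite -mulrBr mulrC ler_wpM2l//.
  have h1 := ball_argmax_le t t0 w s.
  have h2 : sqd u (ball_argmax t w s) <= t + D.
    by have := tri u w (ball_argmax t w s); lra.
  have := ball_max_ge _ tD0 u s _ h2.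
  by rewrite /(ball_max t); lra.
pose o u := signE m (fun s => \sum_w M s u w).
pose dev u := signE m (fun s => `|ball_max (t + D) u s - f' u|) +
  signE m (fun s => `|ball_max t u s - f u|).
have devs : \sum_u p u * dev u <= 2 * tau.
  apply: le_trans (_ : \sum_u p u * (2 * tau) <= _); last by rewrite -mulr_suml p1 mul1r.
  apply: ler_sum => u _; rewrite ler_wpM2l//.
  have h1 := ball_max_deviation _ tD0 u tau tau0 ht.
  have h2 := ball_max_deviation _ t0 u tau tau0 ltac:(lra).
  by apply: le_trans (lerD h1 h2) _; lra.
have := signE_le m _ _ pointwise.
rewrite signEZ [X in _ <= X]signE_sum.
have -> : \sum_u signE m (fun s => f' u * (\sum_w M s u w) + - f u * (\sum_w M s w u) +
    (p u * `|ball_max (t + D) u s - f' u| + p u * `|ball_max t u s - f u|)) =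
    \sum_u o u * f' u - \sum_u o u * f u + \sum_u p u * dev u.
  rewrite -sumrB -big_split; apply: eq_bigr => u _ /=.
  rewrite signED [signE m (fun s => f' u * _ + _)]signED.
  rewrite [signE m (fun s => p u * _ + _)]signED !signEZ -Msym -/(o u) /dev.
  by move: (o u) (f u) (f' u) (signE _ _) (signE _ _) => *; ring.
set S4 := signE m _ => h.
change (sigma * S4 - 2 * tau + \sum_u o u * f u <= \sum_u o u * f' u).
by lra.
Qed.

(** [K] steps from radius 0, where the maxima are nonnegative, give the left side; the maximal
    inequality at radius [K%:R * D] gives the right side. *)
Lemma chaining_symmetric (M : seq R -> V -> V -> R) (D sigma tau : R) (K : nat) :
  (2 <= #|V|)%N ->
  0 < tau -> 0 <= D -> 2 * (K%:R * D) <= tau ^+ 2 ->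
  (forall s u w, 0 <= M s u w) ->
  (forall s u w, M s u w != 0 -> sqd u w <= D /\ sigma <= dot m (v w) s - dot m (v u) s) ->
  (forall s u, \sum_w M s u w <= p u) -> (forall s w, \sum_u M s u w <= p w) ->
  (forall u, signE m (fun s => \sum_w M s u w) = signE m (fun s => \sum_w M s w u)) ->
  K%:R * (sigma * signE m (fun s => \sum_u \sum_w M s u w) - 2 * tau) <=
  Num.sqrt (ln #|V|%:R) * (1 + tau ^+ 2).
Proof.
move=> n2 tau0 D0 hK M0 MD Mout Min Msym.
set c := sigma * _ - _.
have o0 u : 0 <= signE m (fun s => \sum_w M s u w).
  by apply: signE_ge0 => s; apply: sumr_ge0.
have o1 u : signE m (fun s => \sum_w M s u w) <= p u.
  by rewrite -(signE_cst m (p u)); apply: signE_le => s.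
have grow k : (k <= K)%N -> k%:R * c <=
    \sum_u signE m (fun s => \sum_w M s u w) * signE m (ball_max (k%:R * D) u).
  elim: k => [|k IH] kK.
    rewrite mul0r; apply: sumr_ge0 => u _; rewrite mulr_ge0//.
    by apply: signE_ge0 => s; rewrite ball_max_ge0// mul0r.
  have t0 : 0 <= k%:R * D by rewrite mulr_ge0.
  have E : k.+1%:R * D = k%:R * D + D by rewrite -natr1 mulrDl mul1r.
  have ht : 2 * (k%:R * D + D) <= tau ^+ 2.
    by rewrite -E; apply: le_trans hK; rewrite ler_pM2l// ler_wpM2r// ler_nat.
  have := chaining_step M D sigma tau _ tau0 D0 t0 ht M0 MD Mout Min Msym.
  have := IH (ltnW kK); rewrite -/c E -natr1 mulrDl mul1r; lra.
apply: le_trans (grow K (leqnn K)) _.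
have KD0 : 0 <= K%:R * D by rewrite mulr_ge0.
set l := Num.sqrt _.
have l0 : 0 <= l by rewrite sqrtr_ge0.
apply: le_trans (_ : \sum_u p u * (l * (1 + tau ^+ 2)) <= _); last first.
  by rewrite -mulr_suml p1 mul1r.
apply: ler_sum => u _.
apply: le_trans (_ : p u * signE m (ball_max (K%:R * D) u) <= _).
  by rewrite ler_wpM2r//; apply: signE_ge0 => s; rewrite ball_max_ge0.
rewrite ler_wpM2l//; apply: le_trans (ball_max_expectation _ KD0 u n2) _.
by rewrite ler_wpM2l//; lra.
Qed.

(* Replacing [M s u w] by the average of [M s u w] and [M (- s) w u] makes the expected
   in- and out-masses of every vertex equal. *)
Lemma chaining (M : seq R -> V -> V -> R) (D sigma tau : R) (K : nat) :
  (2 <= #|V|)%N ->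
  0 < tau -> 0 <= D -> 2 * (K%:R * D) <= tau ^+ 2 ->
  (forall s u w, 0 <= M s u w) ->
  (forall s u w, M s u w != 0 -> sqd u w <= D /\ sigma <= dot m (v w) s - dot m (v u) s) ->
  (forall s u, \sum_w M s u w <= p u) -> (forall s w, \sum_u M s u w <= p w) ->
  K%:R * (sigma * signE m (fun s => \sum_u \sum_w M s u w) - 2 * tau) <=
  Num.sqrt (ln #|V|%:R) * (1 + tau ^+ 2).
Proof.
move=> n2 tau0 D0 hK M0 MD Mout Min.
pose N s u w := 2^-1 * M s u w + 2^-1 * M (map -%R s) w u.
have Nout s u : \sum_w N s u w = 2^-1 * (\sum_w M s u w) + 2^-1 * (\sum_w M (map -%R s) w u).
  by rewrite big_split /= -!mulr_sumr.
have Nin s w : \sum_u N s u w = 2^-1 * (\sum_u M s u w) + 2^-1 * (\sum_u M (map -%R s) w u).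
  by rewrite big_split /= -!mulr_sumr.
have Eout u : signE m (fun s => \sum_w N s u w) =
    2^-1 * signE m (fun s => \sum_w M s u w) + 2^-1 * signE m (fun s => \sum_w M s w u).
  under eq_signE do rewrite Nout.
  by rewrite signED !signEZ (signE_opp m (fun s => \sum_w M s w u)).
have Ein u : signE m (fun s => \sum_w N s w u) =
    2^-1 * signE m (fun s => \sum_w M s w u) + 2^-1 * signE m (fun s => \sum_w M s u w).
  under eq_signE do rewrite Nin.
  by rewrite signED !signEZ (signE_opp m (fun s => \sum_w M s u w)).
have := @chaining_symmetric N D sigma tau K n2 tau0 D0 hK.
rewrite (_ : signE m (fun s => \sum_u \sum_w N s u w) =
   signE m (fun s => \sum_u \sum_w M s u w)); last first.
  rewrite !signE_sum; under eq_bigr do rewrite Eout.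
  rewrite big_split /= -!mulr_sumr.
  rewrite -[X in _ + _ * X]signE_sum.
  under [X in _ + _ * X]eq_signE do rewrite exchange_big.
  by rewrite signE_sum; lra.
apply.
- by move=> s u w; rewrite /N addr_ge0// mulr_ge0// invr_ge0.
- move=> s u w; rewrite /N; have [Mz|/MD//] := eqVneq (M s u w) 0.
  rewrite Mz mulr0 add0r mulf_eq0 negb_or => /andP[_ /MD[h1 h2]].
  rewrite sqdC; split=> //; rewrite !dot_opp in h2; lra.
- by move=> s u; rewrite Nout; have := Mout s u; have := Min (map -%R s) u; lra.
- by move=> s u; rewrite Nin; have := Min s u; have := Mout (map -%R s) u; lra.
by move=> u; rewrite Eout Ein addrC.
Qed.

(** Let [c] be a median of [x]. A pair with gap [gamma] has an endpoint at distance at least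
    [gamma / 2] from [c], so such vertices have mass at least half of that of the pairs. The heavier
    side of them is one set; the half-line on the other side of [c], of mass at least 1/2, is the
    other. *)
Lemma median_gap (x : V -> R) (gamma : R) : 0 <= gamma ->
  exists A B : {set V}, [/\ forall u w, u \in A -> w \in B -> gamma / 2 <= x w - x u,
    (\sum_u \sum_w p u * p w * (gamma ^+ 2 <= (x w - x u) ^+ 2)%R%:R) / 4 <= \sum_(u in A) p u &
    (\sum_u \sum_w p u * p w * (gamma ^+ 2 <= (x w - x u) ^+ 2)%R%:R) / 4 <= \sum_(u in B) p u].
Proof.
move=> g0; set q := \sum_u _.
have VT : finset.setTfor V != finset.set0.
  apply/eqP => V0; move: p1; rewrite big1 => [|u _]; first by move/eqP; rewrite eq_sym oner_eq0.
  by have := finset.in_setT u; rewrite V0 inE.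
have [c [c1 c2]] := weighted_median p x (finset.setTfor V) p0 VT.
pose far u := gamma / 2 <= `|x u - c|.
pose beta := \sum_(u | far u) p u.
have b1 : beta <= 1.
  by rewrite -p1 /beta [leRHS](bigID far) /= lerDl sumr_ge0.
have q2 : q <= 2 * beta.
  have -> : 2 * beta = \sum_u \sum_w p u * p w * (far u)%:R + \sum_u \sum_w p u * p w * (far w)%:R.
    rewrite [X in _ + X]exchange_big /=.
    have E : \sum_u \sum_w p u * p w * (far u)%:R = beta.
      rewrite /beta [RHS]big_mkcond; apply: eq_bigr => u _.
      rewrite -mulr_suml -mulr_sumr p1 mulr1; case: (far u); by rewrite ?mulr1 ?mulr0.
    under [X in _ = _ + X]eq_bigr do under eq_bigr do rewrite [p _ * p _]mulrC.
    by rewrite !E mulrDl mul1r.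
  rewrite -big_split; apply: ler_sum => u _ /=; rewrite -big_split; apply: ler_sum => w _ /=.
  rewrite -mulrDr ler_wpM2l ?mulr_ge0// -natrD ler_nat.
  have : (gamma ^+ 2 <= (x w - x u) ^+ 2) -> far u || far w.
    move=> h; apply: contraT; rewrite negb_or /far -!ltNge !ltr_norml.
    move=> /andP[/andP[h1 h2] /andP[h3 h4]].
    have h5 : - gamma < x w - x u by lra.
    have h6 : x w - x u < gamma by lra.
    by nra.
  case: (gamma ^+ 2 <= _) => [/(_ isT)|_] //.
  by case: (far u); case: (far w).
have bb : beta <= \sum_(u | c + gamma / 2 <= x u) p u + \sum_(u | x u <= c - gamma / 2) p u.
  rewrite /beta (bigID (fun u => c + gamma / 2 <= x u)) /= lerD//.
    rewrite [leRHS](bigID far) /= [X in X <= _](eq_bigl (fun u => (c + gamma / 2 <= x u) && far u)).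
      by rewrite lerDl sumr_ge0.
    by move=> u; rewrite andbC.
  rewrite big_mkcond [leRHS]big_mkcond; apply: ler_sum => u _.
  case: ifP => [/andP[h1 h2]|_]; last by case: ifP.
  suff -> : x u <= c - gamma / 2 by [].
  by move: h1 h2; rewrite /far ler_normr -ltNge => /orP[] h h'; lra.
have c1' : 1 / 2 <= \sum_(u | c <= x u) p u.
  move: c1; rewrite (eq_bigl predT) ?p1 => [|u]; last by rewrite inE.
  by rewrite (eq_bigl (fun u => c <= x u))// => u; rewrite inE.
have c2' : 1 / 2 <= \sum_(u | x u <= c) p u.
  move: c2; rewrite (eq_bigl predT) ?p1 => [|u]; last by rewrite inE.
  by rewrite (eq_bigl (fun u => x u <= c))// => u; rewrite inE.
have [h|h] := leP (beta / 2) (\sum_(u | c + gamma / 2 <= x u) p u).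
  exists [set u | x u <= c], [set u | c + gamma / 2 <= x u]; split.
  - by move=> u w; rewrite !inE; lra.
  - by under [leRHS]eq_bigl do rewrite inE; lra.
  - by under [leRHS]eq_bigl do rewrite inE; lra.
exists [set u | x u <= c - gamma / 2], [set u | c <= x u]; split.
- by move=> u w; rewrite !inE; lra.
- by under [leRHS]eq_bigl do rewrite inE; lra.
- by under [leRHS]eq_bigl do rewrite inE; lra.
Qed.

(** Take a maximal fractional matching along short pairs from [A] to [B]. If its mass is below
    [b - c], the unsaturated vertices of either side keep mass [c], and by maximality no short pair
    joins them. *)
Lemma separated_or_matching (A B : {set V}) (D b c : R) :
  b <= \sum_(u in A) p u -> b <= \sum_(u in B) p u ->
  (exists A' B' : {set V}, [/\ forall u w, u \in A' -> w \in B' -> D < sqd u w,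
     c <= \sum_(u in A') p u & c <= \sum_(u in B') p u]) \/
  (exists M : V -> V -> R, [/\ forall u w, 0 <= M u w,
     forall u w, M u w != 0 -> [/\ u \in A, w \in B & sqd u w <= D],
     forall u, \sum_w M u w <= p u, forall w, \sum_u M u w <= p w &
     b - c <= \sum_u \sum_w M u w]).
Proof.
move=> bA bB.
have [M [M0 ME Mout Min Mmax]] := maximal_fractional_matching p
  (fun u w => [&& u \in A, w \in B & sqd u w <= D]) p0.
have [h|h] := leP (b - c) (\sum_u \sum_w M u w).
  right; exists M; split=> // u w Muw; apply/and3P.
  by apply: contraNT Muw => /ME ->.
have h' : \sum_w \sum_u M u w < b - c by rewrite exchange_big.
left; exists [set u in A | \sum_w M u w < p u], [set w in B | \sum_u M u w < p w].
have residual (F : V -> R) (C : {set V}) : (forall u, 0 <= F u) -> (forall u, F u <= p u) ->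
    \sum_u F u < b - c -> b <= \sum_(u in C) p u ->
    c <= \sum_(u in [set u in C | F u < p u]) p u.
  move=> F0 Fp Fb bC.
  have : \sum_(u in C) p u <= \sum_(u in [set u in C | F u < p u]) p u + \sum_u F u.
    rewrite big_mkcond [X in _ <= X + _]big_mkcond -big_split; apply: ler_sum => u _ /=.
    rewrite inE; have [uC|uC] /= := boolP (u \in C); last by rewrite add0r.
    case: ltP => h1; first by rewrite lerDl.
    by rewrite add0r.
  lra.
split.
- move=> u w; rewrite !inE => /andP[uA hu] /andP[wB hw]; rewrite ltNge; apply/negP => uw.
  have [e|e] := Mmax u w ltac:(by rewrite uA wB uw).
    by rewrite e ltxx in hu.
  by rewrite e ltxx in hw.
- by apply: residual => // u; apply: sumr_ge0.
- by apply: residual => // u; apply: sumr_ge0.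
Qed.

(** Otherwise every sign vector yields a matching. Pairs of mass 1/2 have a projected gap of 1/3
    with probability 1/5, so [q] has mean at least 1/10 and the matching has mean mass at least 1/40
    - 1/80 = 1/80. With [sigma] = 1/6 the gain per step is 1/480 = [4 * tau], of which [2 * tau]
    survives the deviations, and [K] steps exceed the maximal inequality. *)
Lemma separated_sets (D tau : R) (K : nat) :
  (2 <= #|V|)%N -> tau = 1 / 1920 ->
  1 / 2 <= \sum_u \sum_(w | 1 / 2 <= sqd u w) p u * p w ->
  0 <= D -> 2 * (K%:R * D) <= tau ^+ 2 ->
  Num.sqrt (ln #|V|%:R) * (1 + tau ^+ 2) < K%:R * (2 * tau) ->
  exists A B : {set V}, [/\ forall u w, u \in A -> w \in B -> D < sqd u w,
     1 / 80 <= \sum_(u in A) p u & 1 / 80 <= \sum_(u in B) p u].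
Proof.
move=> n2 htau spread D0 hK hl; apply: contrapT => nosep.
pose x s u := dot m (v u) s.
pose q s := \sum_u \sum_w p u * p w * ((1 / 3) ^+ 2 <= (x s w - x s u) ^+ 2)%R%:R.
have hM s : exists M : V -> V -> R, [/\ forall u w, 0 <= M u w,
     forall u w, M u w != 0 -> sqd u w <= D /\ 1 / 6 <= x s w - x s u,
     forall u, \sum_w M u w <= p u, forall w, \sum_u M u w <= p w &
     q s / 4 - 1 / 80 <= \sum_u \sum_w M u w].
  have g0 : 0 <= 1 / 3 :> R by lra.
  have [A [B [AB hA hB]]] := median_gap (x s) (1 / 3) g0.
  have [//|[M [M0 ME Mout Min Mb]]] := separated_or_matching A B D _ (1 / 80) hA hB.
  exists M; split=> // u w /ME[uA wB uw]; split=> //.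
  by have := AB u w uA wB; lra.
have [M hM'] := choice hM.
have tau0 : 0 < tau by lra.
have := @chaining M D (1 / 6) tau K n2 tau0 D0 hK.
move=> /(_ (fun s => let: And5 h _ _ _ _ := hM' s in h)).
move=> /(_ (fun s => let: And5 _ h _ _ _ := hM' s in h)).
move=> /(_ (fun s => let: And5 _ _ h _ _ := hM' s in h)).
move=> /(_ (fun s => let: And5 _ _ _ h _ := hM' s in h)).
have E1 : signE m (fun s => 4^-1 * q s - 1 / 80) <= signE m (fun s => \sum_u \sum_w M s u w).
  by apply: signE_le => s; have [_ _ _ _] := hM' s; rewrite mulrC.
rewrite signEB signEZ signE_cst in E1.
have E2 : 1 / 10 <= signE m q.
  rewrite /q signE_sum.
  apply: le_trans (_ : 1 / 5 * (\sum_u \sum_(w | 1 / 2 <= sqd u w) p u * p w) <= _).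
    by lra.
  rewrite mulr_sumr; apply: ler_sum => u _; rewrite signE_sum mulr_sumr big_mkcond.
  apply: ler_sum => w _; rewrite signEZ.
  have pp : 0 <= p u * p w by rewrite mulr_ge0.
  case: ifP => [uw|_]; last first.
    by rewrite mulr_ge0//; apply: signE_ge0 => s; exact: ler0n.
  rewrite mulrC ler_wpM2l//.
  (* 4/9 is below the squared distance 1/2, and a quarter of it is the square of the gap 1/3. *)
  have := @signE_dot_anticoncentration _ m (fun k => v w k - v u k) (4 / 9) ltac:(lra).
  rewrite -/(sqd w u) sqdC => /(_ ltac:(lra)) h; apply: le_trans h _.
  apply: signE_le => s; rewrite dotB ler_nat.
  by rewrite (_ : 4 / 9 / 4 = (1 / 3) ^+ 2 :> R)//; field.
set EM := signE m (fun s => \sum_u \sum_w M s u w) in E1 *.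
have K0 : 0 <= K%:R :> R by [].
have : K%:R * (2 * tau) <= K%:R * (1 / 6 * EM - 2 * tau).
  by rewrite ler_wpM2l//; lra.
by move: hl; lra.
Qed.

(** Here [h] is a lower bound for the distance to [L]. If a ball of squared radius 1/2 has half of
    the mass, it serves as [L], since the mean distance to its centre is at least 1. If there is
    none, half of the pairs are far apart and [L] is one of two separated sets. *)
Lemma arv_frechet : (2 <= #|V|)%N -> 2 <= \sum_u \sum_w p u * p w * sqd u w ->
  exists (L : {set V}) (h : V -> R), [/\ 1 / 80 <= \sum_(u in L) p u,
    forall u, 0 <= h u, forall u w, u \in L -> h w <= sqd u w &
    1 <= 160 * 2000 ^+ 3 * Num.sqrt (ln #|V|%:R) * \sum_u p u * h u].
Proof.
move=> n2 spread; set l := Num.sqrt _.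
(* This lets [l] absorb additive constants: the lower bound in the first case and the rounding of
   [K] in the second. *)
have l12 : 1 / 2 <= l.
  have h2 : 1 / 2 <= ln #|V|%:R :> R.
    apply: le_trans (_ : ln 2 <= _); last by rewrite ler_ln ?posrE ?ler_nat// ltr0n (ltn_trans _ n2).
    have := @ln_sublinear R (1 / 2); have := @le_ln1Dx R (- (1 / 2)) ltac:(lra).
    rewrite (_ : 1 + - (1 / 2) = 2^-1 :> R); last by field.
    by rewrite lnV ?posrE//; lra.
  have := sqrtr_ge0 (ln #|V|%:R : R); have := sqr_sqrtr (le_trans _ h2 : 0 <= ln #|V|%:R).
  by rewrite -/l => /(_ ltac:(lra)); nra.
have [[x hx]|nox] := pselect (exists x, 1 / 2 <= \sum_(y | sqd x y <= 1 / 2) p y).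
  exists [set y | sqd x y <= 1 / 2], (fun y => Num.max 0 (sqd x y - 1 / 2)); split.
  - by under eq_bigl do rewrite inE; lra.
  - by move=> u; rewrite le_max lexx.
  - move=> u w; rewrite inE ge_max sqd_ge0 /= => xu; have := tri x u w; lra.
  have : 1 <= \sum_u p u * sqd x u.
    have : \sum_u \sum_w p u * p w * sqd u w <=
        \sum_u \sum_w (p u * sqd x u * p w + p u * (p w * sqd x w)).
      apply: ler_sum => u _; apply: ler_sum => w _.
      have := tri u x w; rewrite (sqdC u x).
      have pp : 0 <= p u * p w by rewrite mulr_ge0.
      by move=> /(ler_wpM2l pp); rewrite mulrDr; lra.
    rewrite [leRHS](_ : _ = 2 * \sum_u p u * sqd x u); first by lra.
    under eq_bigr do rewrite big_split /= -!mulr_sumr p1 mulr1.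
    by rewrite big_split /= -mulr_suml p1; ring.
  have : \sum_u p u * sqd x u - 1 / 2 <= \sum_u p u * Num.max 0 (sqd x u - 1 / 2).
    apply: le_trans (_ : \sum_u p u * (sqd x u - 1 / 2) <= _).
      under [leRHS]eq_bigr do rewrite mulrBr.
      by rewrite sumrB -mulr_suml p1; lra.
    by apply: ler_sum => u _; rewrite ler_wpM2l// le_max lexx orbT.
  set S := \sum_u p u * Num.max _ _ => h1 h2.
  have S12 : 1 / 2 <= S by lra.
  have : 1 / 4 <= l * S by nra.
  by rewrite -mulrA; lra.
have far : 1 / 2 <= \sum_u \sum_(w | 1 / 2 <= sqd u w) p u * p w.
  apply: le_trans (_ : \sum_u p u * (1 / 2) <= _); first by rewrite -mulr_suml p1; lra.
  apply: ler_sum => u _.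
  rewrite -mulr_sumr ler_wpM2l//.
  have : \sum_(y | sqd u y <= 1 / 2) p y < 1 / 2.
    by rewrite ltNge; apply/negP => h; apply: nox; exists u.
  have : 1 <= \sum_(y | sqd u y <= 1 / 2) p y + \sum_(y | 1 / 2 <= sqd u y) p y.
    rewrite -[leLHS]p1 (bigID (fun y => sqd u y <= 1 / 2)) /= lerD2l.
    rewrite big_mkcond [leRHS]big_mkcond; apply: ler_sum => y _.
    by case: (leP (sqd u y) (1 / 2)) => /= [_|/ltW ->]; first by case: ifP.
  lra.
(* [K] exceeds [1920 * l], so [K%:R * (2 * tau)] exceeds [2 * l], which is above
   [l * (1 + tau ^+ 2)]. [D] then uses up the allowed radius and is of order [1 / l]. *)
pose K := (Num.truncn (1920 * l)).+1.
have K1 : 1920 * l < K%:R by exact: truncnS_gt.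
have K2 : K%:R <= 1922 * l.
  have : (Num.truncn (1920 * l))%:R <= 1920 * l by rewrite truncn_le; lra.
  rewrite /K -natr1; lra.
have K0 : 0 < K%:R :> R by rewrite ltr0n.
pose tau : R := 1 / 1920.
pose D := tau ^+ 2 / (2 * K%:R).
have KD : K%:R * D = tau ^+ 2 / 2.
  by rewrite /D; field; rewrite gt_eqF.
have D0 : 0 <= D by rewrite divr_ge0// ?sqr_ge0// mulr_ge0// ltW.
have [A [B [AB hA hB]]] := separated_sets D tau K n2 erefl far D0
  ltac:(by rewrite KD; lra)
  ltac:(by rewrite -/l /tau; lra).
exists A, (fun w => if w \in B then D else 0); split=> //.
- by move=> u; case: ifP.
- by move=> u w uA; case: ifP => [wB|_]; [exact/ltW/AB|exact: sqd_ge0].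
have : D * (1 / 80) <= \sum_u p u * (if u \in B then D else 0).
  apply: le_trans (_ : \sum_(u in B) p u * D <= _).
    by rewrite -mulr_suml mulrC ler_wpM2r.
  by rewrite big_mkcond; apply: ler_sum => u _; case: ifP; rewrite ?mulr0.
set S := \sum_u _ => hS.
(* The final constant comes from 2 * 80 * 1922 * 1920^2, with the last two factors rounded up to
   2000^3. *)
have : tau ^+ 2 / 2 <= 1922 * l * D by rewrite -KD ler_wpM2r.
have l0 : 0 <= l by lra.
have : l * (D * (1 / 80)) <= l * S by rewrite ler_wpM2l.
rewrite /tau -mulrA.
lra.
Qed.

End Chaining.

(** * Threshold cuts *)

Section DirectedCut.
Context {R : realType} {n : nat} {E : finType}.
Variables (Hd Tl : E -> {set 'I_n}) (w : E -> R) (pi : 'I_n -> R).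
Hypothesis w0 : forall e, 0 < w e.
Hypothesis pi0 : forall i, 0 < pi i.

Lemma piS_gt0 (S : {set 'I_n}) : S != finset.set0 -> 0 < piS pi S.
Proof.
case/set0Pn => i iS; rewrite /piS (bigD1 i)//=.
by apply: ltr_wpDr => //; apply: sumr_ge0 => j _; exact/ltW.
Qed.

Lemma piS_ge0 (S : {set 'I_n}) : 0 <= piS pi S.
Proof. by apply: sumr_ge0 => j _; exact/ltW. Qed.

Lemma piS_setC (S : {set 'I_n}) : piS pi S + piS pi (~: S) = \sum_i pi i.
Proof.
rewrite [RHS](bigID (mem S)) /=; congr (_ + _).
by apply: eq_bigl => i; rewrite inE.
Qed.

Lemma wout_ge0 (S : {set 'I_n}) : 0 <= wout Hd Tl w S.
Proof. by apply: sumr_ge0 => j _; exact/ltW. Qed.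

Lemma setC_eq0 (S : {set 'I_n}) : (~: S == finset.set0) = (S == finset.setTfor 'I_n).
Proof. by rewrite -(inj_eq (@finset.setC_inj _)) finset.setCK finset.setC0. Qed.

Lemma dphiS_ge0 (S : {set 'I_n}) : 0 <= dphiS Hd Tl w pi S.
Proof. by rewrite divr_ge0// le_min ?wout_ge0 ?piS_ge0. Qed.

Lemma dphi_ge0 : 0 <= dphi Hd Tl w pi.
Proof. 
have h x : (exists S : {set 'I_n}, [/\ S != finset.set0, S != finset.setTfor 'I_n &
    x = dphiS Hd Tl w pi S]) -> 0 <= x.
  by move=> [S [_ _ ->]]; exact: dphiS_ge0.
have [ne|e] := pselect (nonempty [set x | exists S : {set 'I_n},
    [/\ S != finset.set0, S != finset.setTfor 'I_n & x = dphiS Hd Tl w pi S]])%classic.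
  exact: lb_le_inf.
(* Without a proper cut the infimum has its default value 0. *)
by rewrite /dphi inf_out// => -[].
Qed.

Lemma dphi_le (S : {set 'I_n}) : S != finset.set0 -> S != finset.setTfor 'I_n ->
  dphi Hd Tl w pi <= dphiS Hd Tl w pi S.
Proof.
move=> S0 ST; apply: ge_inf; last by exists S.
by exists 0 => _ [T [_ _ ->]]; exact: dphiS_ge0.
Qed.

Lemma dphi_mul_le (S : {set 'I_n}) : S != finset.set0 -> S != finset.setTfor 'I_n ->
  dphi Hd Tl w pi * Num.min (piS pi S) (piS pi (~: S)) <=
  Num.min (wout Hd Tl w S) (wout Hd Tl w (~: S)).
Proof.
move=> S0 ST; have := dphi_le S S0 ST; rewrite /dphiS.
have h : 0 < Num.min (piS pi S) (piS pi (~: S)).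
  by rewrite lt_min !piS_gt0// setC_eq0.
by rewrite ler_pdivlMr.
Qed.

(** Reversing all hyperedges exchanges the two directions of a cut, so one sweep lemma serves both
    distance functions. *)
Lemma wout_swap (S : {set 'I_n}) : wout Tl Hd w S = wout Hd Tl w (~: S).
Proof. by apply: eq_bigl => e; rewrite finset.setCK andbC. Qed.

(* Subtracting from [f] its least positive value on its support [S] decreases [\sum_e w e
   * q e] by at least a multiple of [wout S], and shrinks the support: this is the
   discrete co-area formula. *)
Lemma threshold_sweep (Z : {set 'I_n}) (c : R) (f : 'I_n -> R) (q : E -> R) :
  (forall S : {set 'I_n}, S != finset.set0 -> [disjoint S & Z] ->
     c * piS pi S <= wout Hd Tl w S) ->
  (forall i, 0 <= f i) -> (forall i, i \in Z -> f i = 0) -> (forall e, 0 <= q e) ->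
  (forall e i j, i \in Hd e -> j \in Tl e -> f j - f i <= q e) ->
  c * \sum_i pi i * f i <= \sum_e w e * q e.
Proof.
move=> hS.
have [N] := ubnP #|[set i | 0 < f i]|; elim: N => // N IH in f q *.
rewrite ltnS => fN f0 fZ q0 fq.
set S := [set i | 0 < f i].
have [S0|SN0] := eqVneq S finset.set0.
  rewrite big1 ?mulr0 => [|i _]; first by apply: sumr_ge0 => e _; rewrite mulr_ge0// ltW.
  have : i \notin S by rewrite S0 inE.
  by rewrite inE -leNgt => h; rewrite (le_anti (_ : f i <= 0 <= f i)) ?mulr0// h f0.
have [i0 i0S] := set0Pn _ SN0.
have [i iS imin] : exists2 i, i \in S & forall j, j \in S -> f i <= f j.
  by case: (arg_minP f i0S) => i iS hi; exists i.
have i_gt0 : 0 < f i by rewrite inE in iS.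
have notS j : j \notin S -> f j = 0.
  by rewrite inE -leNgt => h; apply/le_anti; rewrite h f0.
set t := f i in imin i_gt0.
pose cut e := (Tl e :&: S != finset.set0) && (Hd e :&: ~: S != finset.set0).
pose f' j := f j - (if j \in S then t else 0).
pose q' e := q e - (if cut e then t else 0).
have cutP e : cut e -> exists j k, [/\ j \in Tl e, j \in S, k \in Hd e & k \notin S].
  case/andP => /set0Pn[j]; rewrite inE => /andP[jT jS] /set0Pn[k].
  by rewrite inE [k \in ~: S]inE => /andP[kH kS]; exists j, k.
have f'0 j : 0 <= f' j.
  by rewrite /f'; case: ifP => [/imin|_]; rewrite ?subr0 ?subr_ge0.
have : c * (\sum_j pi j * f' j) <= \sum_e w e * q' e.
  apply: IH => //.
  - apply: leq_trans fN; apply: proper_card; apply/properP; split.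
      apply/fintype.subsetP => j; rewrite !inE /f' => h; apply: lt_le_trans h _.
      by case: ifP => _; rewrite ?subr0// gerDl oppr_le0 ltW.
    by exists i => //; rewrite inE /f' iS subrr ltxx.
  - by move=> j jZ; rewrite /f' inE fZ// ltxx subr0.
  - move=> e; rewrite /q'; case: ifP => [/cutP[j [k [jT jS kH kS]]]|_]; last by rewrite subr0.
    by have := fq e k j kH jT; have := imin _ jS; rewrite (notS k kS); lra.
  move=> e k j kH jT; have h := fq e k j kH jT.
  have k0 := f'0 k; have qe := q0 e.
  have [jS|jS] := boolP (j \in S); last first.
    rewrite {1}/f' (negbTE jS) (notS j jS) /q'.
    case: ifP => [/cutP[j1 [k1 [jT1 jS1 kH1 kS1]]]|_]; last by lra.
    by have := fq e k1 j1 kH1 jT1; have := imin _ jS1; rewrite (notS k1 kS1); lra.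
  have [kS|kS] := boolP (k \in S); last first.
    have ce : cut e.
      apply/andP; split; apply/set0Pn; [exists j|exists k]; first by rewrite inE jT.
      by rewrite inE kH inE.
    by rewrite /f' /q' ce jS (negbTE kS); lra.
  (* If [e] is cut although [j] and [k] are both in [S], comparing [j] with a head vertex outside
     [S] gives [f j <= q e], and [f k] is at least [t]. *)
  rewrite /f' jS kS /q'; case: ifP => [/cutP[j1 [k1 [jT1 jS1 kH1 kS1]]]|_]; last by lra.
  by have := fq e k1 j kH1 jT; have := imin _ kS; rewrite (notS k1 kS1); lra.
have disj : [disjoint S & Z].
  by rewrite disjoint_subset; apply/fintype.subsetP => j; rewrite !inE => h; apply/negP => /fZ e; rewrite e ltxx in h.
have := hS S SN0 disj => h /(lerD (ler_wpM2l (ltW i_gt0) h)).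
have -> : t * (c * piS pi S) + c * (\sum_j pi j * f' j) = c * \sum_j pi j * f j.
  rewrite mulrCA -mulrDr; congr (c * _).
  rewrite /piS big_mkcond mulr_sumr -big_split; apply: eq_bigr => j _ /=.
  by rewrite /f'; case: ifP => _; ring.
suff -> : t * wout Hd Tl w S + \sum_e w e * q' e = \sum_e w e * q e by [].
rewrite /wout big_mkcond mulr_sumr -big_split; apply: eq_bigr => e _ /=.
by rewrite /q' -/(cut e); case: ifP => _; ring.
Qed.

End DirectedCut.

Section FrechetCut.
Context {R : realType} {n : nat} {E : finType}.
Variables (Hd Tl : E -> {set 'I_n}) (w : E -> R) (pi : 'I_n -> R).
Hypothesis w0 : forall e, 0 < w e.
Hypothesis pi0 : forall i, 0 < pi i.

(* [q] and [r] are the dual variables of the flow problem; [rho i j] = max(0, d i j + r i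
   - r j) is a directed semimetric. *)
Lemma dphi_frechet (d : 'I_n -> 'I_n -> R) (q : E -> R) (r h : 'I_n -> R)
    (L : {set 'I_n}) (c : R) :
  (forall i, d i i = 0) -> (forall i j, d i j = d j i) ->
  (forall i j k, d i k <= d i j + d j k) ->
  (forall e, 0 <= q e) ->
  (forall e i j, i \in Hd e -> j \in Tl e -> d i j + r i - r j <= q e) ->
  (forall i, 0 <= h i) -> (forall i j, i \in L -> h j <= d i j) ->
  L != finset.set0 -> 0 < c -> c <= 1 -> c * \sum_i pi i <= piS pi L ->
  dphi Hd Tl w pi * c * \sum_i pi i * h i <= 4 * \sum_e w e * q e.
Proof.
move=> dxx dC tri q0 dq h0 hL L0 c0 c1 cL.
have dphi0 : 0 <= dphi Hd Tl w pi by exact: dphi_ge0.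
set P := \sum_i pi i in cL.
have P0 : 0 < P.
  have [i _] := set0Pn _ L0.
  by rewrite /P (bigD1 i)//=; apply: ltr_wpDr => //; apply: sumr_ge0 => j _; exact/ltW.
have [m [hge hle]] := weighted_median pi r L (fun i => ltW (pi0 i)) L0.
rewrite -/(piS pi L) in hge hle.
pose rho i j := Num.max 0 (d i j + r i - r j).
have rho0 i j : 0 <= rho i j by rewrite le_max lexx.
have rho_ge i j : d i j + r i - r j <= rho i j by rewrite le_max lexx orbT.
have rhoxx i : rho i i = 0 by rewrite /rho dxx addrK maxxx.
have rho_tri i j k : rho i k <= rho i j + rho j k.
  rewrite {1}/rho ge_max addr_ge0//=; have := tri i j k.
  by have := rho_ge i j; have := rho_ge j k; lra.
have rhoq e i j : i \in Hd e -> j \in Tl e -> rho i j <= q e.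
  by move=> iH jT; rewrite ge_max q0 dq.
(* The complement of a set avoiding [Z] has measure at least [c * P / 2], so the smaller side of the
   cut has at least [c / 2] times the measure of [S]. *)
have cut (Z : {set 'I_n}) : piS pi L / 2 <= piS pi Z ->
    forall S : {set 'I_n}, S != finset.set0 -> [disjoint S & Z] ->
    dphi Hd Tl w pi * (c / 2) * piS pi S <= Num.min (wout Hd Tl w S) (wout Tl Hd w S).
  move=> hZ S S0 SZ.
  have ZS : piS pi Z <= piS pi (~: S).
    rewrite /piS big_mkcond [leRHS]big_mkcond; apply: ler_sum => i _ /=.
    rewrite inE; have [iZ|_] := boolP (i \in Z); last by case: ifP => // _; exact/ltW.
    by rewrite (disjointFl SZ iZ).
  have ST : S != finset.setTfor 'I_n.
    apply/eqP => E0; move: ZS; rewrite E0 finset.setCT [piS pi finset.set0]big_set0.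
    have : 0 < c * P by rewrite mulr_gt0.
    by lra.
  rewrite (wout_swap Hd Tl); apply: le_trans (dphi_mul_le Hd Tl w pi w0 pi0 S S0 ST).
  rewrite -mulrA ler_wpM2l// le_min.
  have SP : piS pi S <= P by rewrite /P -(piS_setC pi S) lerDl piS_ge0.
  have S1 := piS_ge0 pi pi0 S.
  apply/andP; split; first by nra.
  have : c * piS pi S <= c * P by rewrite ler_pM2l.
  by lra.
have nonempty (Z : {set 'I_n}) : piS pi L / 2 <= piS pi Z -> exists i, i \in Z.
  move=> hZ; apply/set0Pn/eqP => Z0; move: hZ; rewrite Z0 /piS big_set0 -/(piS pi L).
  by have := piS_gt0 pi pi0 L L0; lra.
pose Lge := [set i in L | m <= r i]; pose Lle := [set i in L | r i <= m].
have {}hge : piS pi L / 2 <= piS pi Lge.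
  by apply: le_trans hge _; rewrite /piS; under [leRHS]eq_bigl do rewrite inE.
have {}hle : piS pi L / 2 <= piS pi Lle.
  by apply: le_trans hle _; rewrite /piS; under [leRHS]eq_bigl do rewrite inE.
(* [f] is the directed distance from the upper half of [L], and [g] below is the one to the lower
   half; both minima are attained. *)
have /choice[f hf] : forall j, exists y : R, (exists2 i, i \in Lge & y = rho i j) /\
    forall i, i \in Lge -> y <= rho i j.
  move=> j; have [i0 i0L] := nonempty _ hge.
  case: (arg_minP (fun i => rho i j) i0L) => i iL hi.
  by exists (rho i j); split=> //; exists i.
have /choice[g hg] : forall j, exists y : R, (exists2 i, i \in Lle & y = rho j i) /\
    forall i, i \in Lle -> y <= rho j i.
  move=> j; have [i0 i0L] := nonempty _ hle.
  case: (arg_minP (fun i => rho j i) i0L) => i iL hi.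
  by exists (rho j i); split=> //; exists i.
have f0 j : 0 <= f j by have [[i _ ->] _] := hf j.
have g0 j : 0 <= g j by have [[i _ ->] _] := hg j.
have F : dphi Hd Tl w pi * (c / 2) * (\sum_i pi i * f i) <= \sum_e w e * q e.
  apply: (threshold_sweep Hd Tl w pi w0 Lge) => //.
  - by move=> S S0 SZ; apply: le_trans (cut _ hge S S0 SZ) _; rewrite ge_min lexx.
  - by move=> i iZ; apply/le_anti; rewrite f0 andbT -(rhoxx i); apply (hf i).2.
  move=> e i j iH jT; apply: le_trans (rhoq _ _ _ iH jT).
  have [[k kL fi] _] := hf i; have := (hf j).2 k kL; have := rho_tri k i j.
  by rewrite fi; lra.
(* [g] grows from tails to heads, so the sweep is applied to the reversed hypergraph. *)
have G : dphi Hd Tl w pi * (c / 2) * (\sum_i pi i * g i) <= \sum_e w e * q e.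
  apply: (threshold_sweep Tl Hd w pi w0 Lle) => //.
  - by move=> S S0 SZ; apply: le_trans (cut _ hle S S0 SZ) _; rewrite ge_min lexx orbT.
  - by move=> i iZ; apply/le_anti; rewrite g0 andbT -(rhoxx i); apply (hg i).2.
  move=> e j i jT iH; apply: le_trans (rhoq _ _ _ iH jT).
  have [[k kL gj] _] := hg j; have := (hg i).2 k kL; have := rho_tri i j k.
  by rewrite gj; lra.
have : \sum_i pi i * h i <= \sum_i pi i * f i + \sum_i pi i * g i.
  rewrite -big_split; apply: ler_sum => j _ /=; rewrite -mulrDr ler_pM2l//.
  have [[i iL fj] _] := hf j; have [[k kL gj] _] := hg j.
  move: iL kL; rewrite !inE => /andP[iL mi] /andP[kL km].
  have := hL i j iL; have := hL k j kL; have := rho_ge i j; have := rho_ge j k.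
  have := f0 j; have := g0 j; rewrite -fj -gj (dC j k).
  (* If [r j <= m], the potential difference from the upper half is nonnegative and [f j] is at
     least [h j]; otherwise the same holds for [g j] and the lower half. *)
  by have [mj|mj] := leP (r j) m; lra.
move=> hh; have : 0 <= dphi Hd Tl w pi * (c / 2) by rewrite mulr_ge0//; lra.
move=> /ler_wpM2l => /(_ _ _ hh); lra.
Qed.

End FrechetCut.

(** * Flow duality and the semidefinite program *)

Section FlowDuality.
Context {R : realType} {n : nat} {E : finType}.
Variables (Hd Tl : E -> {set 'I_n}) (w : E -> R).

Lemma sum_triple (F : E * ('I_n * 'I_n) -> R) :
  \sum_p F p = \sum_e \sum_i \sum_j F (e, (i, j)).
Proof.
under [RHS]eq_bigr do rewrite pair_big /=.
by rewrite pair_big /=; apply: eq_bigr => -[e [i j]].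
Qed.

(** Farkas applied to the dual constraints with budget [Lam]. In a certificate of infeasibility the
    columns of [q] express the capacities and those of [r] the conservation law, so after division
    by the multiplier of the budget it is a feasible flow of value above [Lam]. *)
Lemma flow_duality (d : 'I_n -> 'I_n -> R) (Lam : R) :
  (forall F, flow_feasible Hd Tl w F -> \sum_i \sum_j F i j * d i j <= Lam) ->
  exists (q : E -> R) (r : 'I_n -> R), [/\ forall e, 0 <= q e,
    forall e i j, i \in Hd e -> j \in Tl e -> d i j + r i - r j <= q e &
    \sum_e w e * q e <= Lam].
Proof.
move=> hF.
pose K : finType := (E + 'I_n)%type.
pose I : finType := ((unit + E) + E * ('I_n * 'I_n))%type.
pose on (p : E * ('I_n * 'I_n)) := (p.2.1 \in Hd p.1) && (p.2.2 \in Tl p.1).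
pose a (c : I) (k : K) : R := match c, k with
  | inl (inl _), inl e => w e
  | inl (inl _), inr _ => 0
  | inl (inr e), inl e' => - (e' == e)%:R
  | inl (inr _), inr _ => 0
  | inr p, inl e => if on p then - (e == p.1)%:R else 0
  | inr p, inr k => if on p then (k == p.2.1)%:R - (k == p.2.2)%:R else 0 end.
pose b (c : I) : R := match c with
  | inl (inl _) => Lam
  | inl (inr _) => 0
  | inr p => if on p then - d p.2.1 p.2.2 else 0 end.
have pick1 (T : finType) (F : T -> R) i1 : \sum_i (i == i1)%:R * F i = F i1.
  rewrite (bigD1 i1)//= eqxx mul1r big1 ?addr0// => j /negbTE ->; exact: mul0r.
have [[x hx]|[y [y0 yK yb]]] := farkas _ (index_enum K) I a b (index_enum_uniq K).
  exists (fun e => x (inl e)), (fun i => x (inr i)).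
  have {}hx c : \sum_e a c (inl e) * x (inl e) + \sum_k a c (inr k) * x (inr k) <= b c.
    by have := hx c; rewrite big_sumType.
  split.
  - move=> e; have := hx (inl (inr e)); rewrite /= [X in _ + X]big1 => [|k _]; last exact: mul0r.
    under eq_bigr do rewrite mulNr.
    by rewrite sumrN pick1 addr0 oppr_le0.
  - move=> e i j iH jT; have := hx (inr (e, (i, j))).
    rewrite /= /on /= iH jT /=.
    under eq_bigr do rewrite mulNr.
    under [X in _ + X]eq_bigr do rewrite mulrBl.
    by rewrite sumrN sumrB !pick1; lra.
  by have := hx (inl (inl tt)); rewrite /= [X in _ + X]big1 ?addr0// => k _; exact: mul0r.
exfalso.
pose y1 := y (inl (inl tt)).
pose G e i j := if on (e, (i, j)) then y (inr (e, (i, j))) else 0.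
have G0 e i j : 0 <= G e i j by rewrite /G; case: ifP.
have split3 (c : I -> R) : \sum_i y i * c i = y1 * c (inl (inl tt)) +
    \sum_e y (inl (inr e)) * c (inl (inr e)) +
    \sum_e \sum_i \sum_j y (inr (e, (i, j))) * c (inr (e, (i, j))).
  rewrite big_sumType big_sumType (big_pred1 tt) => [|[]//].
  by rewrite -[in RHS](sum_triple (fun p => y (inr p) * c (inr p))).
have Gsum e : \sum_i \sum_j G e i j <= y1 * w e.
  have := yK (inl e) (mem_index_enum _).
  rewrite (split3 (fun c => a c (inl e))) /=.
  have -> : \sum_e0 y (inl (inr e0)) * - (e == e0)%:R = - y (inl (inr e)).
    rewrite -(pick1 _ (fun e0 => y (inl (inr e0))) e) -sumrN; apply: eq_bigr => e1 _.
    by rewrite mulrN mulrC eq_sym.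
  have -> : \sum_e0 \sum_i \sum_j y (inr (e0, (i, j))) *
      (if on (e0, (i, j)) then - (e == e0)%:R else 0) = - \sum_i \sum_j G e i j.
    rewrite -(pick1 _ (fun e0 => \sum_i \sum_j G e0 i j) e) -sumrN; apply: eq_bigr => e1 _.
    rewrite mulr_sumr -sumrN; apply: eq_bigr => i _.
    rewrite mulr_sumr -sumrN; apply: eq_bigr => j _.
    by rewrite /G eq_sym; case: ifP => _; rewrite ?mulr0 ?oppr0// mulrN mulrC.
  have := y0 (inl (inr e)); rewrite -/y1; lra.
have Gcirc k : \sum_e \sum_j G e k j = \sum_e \sum_i G e i k.
  have := yK (inr k) (mem_index_enum _).
  rewrite (split3 (fun c => a c (inr k))) /= mulr0 add0r big1 ?add0r => [|e _]; last exact: mulr0.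
  move=> h; apply/eqP; rewrite -subr_eq0 -sumrB -[X in _ == X]h; apply/eqP/eq_bigr => e _.
  have -> : \sum_j G e k j = \sum_i \sum_j G e i j * (k == i)%:R.
    rewrite -(pick1 _ (fun i => \sum_j G e i j) k); apply: eq_bigr => i _.
    by rewrite mulr_sumr; apply: eq_bigr => j _; rewrite mulrC eq_sym.
  have -> : \sum_i G e i k = \sum_i \sum_j G e i j * (k == j)%:R.
    apply: eq_bigr => i _; rewrite -(pick1 _ (fun j => G e i j) k).
    by apply: eq_bigr => j _; rewrite mulrC eq_sym.
  rewrite -sumrB; apply: eq_bigr => i _; rewrite -sumrB; apply: eq_bigr => j _.
  by rewrite -mulrBr /G; case: ifP => _; rewrite ?mul0r ?mulr0.
have Gd : y1 * Lam < \sum_e \sum_i \sum_j G e i j * d i j.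
  have := yb; rewrite (split3 b) /= [X in _ + X + _]big1 => [|e _]; last exact: mulr0.
  have -> : \sum_e \sum_i \sum_j y (inr (e, (i, j))) *
     (if on (e, (i, j)) then - d i j else 0) = - \sum_e \sum_i \sum_j G e i j * d i j.
    rewrite -sumrN; apply: eq_bigr => e _; rewrite -sumrN; apply: eq_bigr => i _.
    rewrite -sumrN; apply: eq_bigr => j _.
    by rewrite /G; case: ifP => _; rewrite ?mul0r ?mulr0 ?oppr0// mulrN.
  by lra.
have y1_ge0 : 0 <= y1 by exact: y0.
(* If the budget has multiplier 0, all capacities of [G] are 0, so [G] vanishes and cannot have
   positive value. *)
have [y1z|y1n] := eqVneq y1 0.
  move: Gd; rewrite y1z mul0r ltNge => /negP; apply.
  rewrite big1// => e _; rewrite big1// => i _; rewrite big1// => j _.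
  have := Gsum e; rewrite y1z mul0r => h.
  suff -> : G e i j = 0 by rewrite mul0r.
  apply/le_anti; rewrite G0 andbT; apply: le_trans h.
  rewrite (bigD1 i)//= (bigD1 j)//= -addrA lerDl addr_ge0//; apply: sumr_ge0 => k _ //.
  exact: sumr_ge0.
have y1_gt0 : 0 < y1 by rewrite lt_def y1n.
pose Fe e i j := G e i j / y1.
have : \sum_i \sum_j (\sum_e Fe e i j) * d i j <= Lam.
  apply: hF; exists Fe; split.
  - by move=> e i j _ _; rewrite divr_ge0.
  - move=> i j; rewrite big_mkcond [RHS]big_mkcond; apply: eq_bigr => e _ /=.
    by rewrite /Fe /G /on /=; case: ifP; rewrite ?mul0r.
  - move=> e; rewrite -(ler_pM2l y1_gt0); apply: le_trans (Gsum e).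
    rewrite mulr_sumr big_mkcond; apply: ler_sum => i _.
    case: ifP => _; last exact: sumr_ge0.
    rewrite mulr_sumr big_mkcond; apply: ler_sum => j _.
    by case: ifP => _; rewrite // /Fe mulrC divfK.
  move=> k; rewrite exchange_big [RHS]exchange_big /=.
  rewrite -[LHS]/(\sum_e \sum_i G e i k / y1) -[RHS]/(\sum_e \sum_j G e k j / y1).
  by under eq_bigr do rewrite -mulr_suml; under [RHS]eq_bigr do rewrite -mulr_suml;
     rewrite -!mulr_suml Gcirc.
rewrite -(ler_pM2l y1_gt0) leNgt => /negP; apply; apply: lt_le_trans Gd _.
rewrite mulr_sumr exchange_big; apply: ler_sum => i _ /=.
rewrite mulr_sumr exchange_big; apply: ler_sum => j _ /=.
rewrite mulr_suml mulr_sumr; apply: ler_sum => e _.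
by rewrite /Fe mulrA [y1 * _]mulrC divfK.
Qed.

End FlowDuality.

Section SdpValue.
Context {R : realType} {n : nat} {E : finType}.
Variables (Hd Tl : E -> {set 'I_n}) (w : E -> R).
Hypothesis w0 : forall e, 0 < w e.
Implicit Types (v : 'I_n -> 'I_n -> R).

Lemma sqdist_ge0 v i j : 0 <= sqdist v i j.
Proof. by apply: sumr_ge0 => k _; exact: sqr_ge0. Qed.

Lemma sqdistxx v i : sqdist v i i = 0.
Proof. by apply: big1 => k _; rewrite subrr expr0n. Qed.

Lemma sqdistC v i j : sqdist v i j = sqdist v j i.
Proof. by apply: eq_bigr => k _; rewrite -sqrrN opprB. Qed.

Lemma sdp_objE v F : sdp_obj v F = 2^-1 * \sum_i \sum_j F i j * sqdist v i j.
Proof.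
have -> : \sum_i \sum_j F i j * sqdist v i j =
    \sum_(i < n) \sum_(j < n | (i < j)%N) F i j * sqdist v i j +
    \sum_(i < n) \sum_(j < n | (i < j)%N) F j i * sqdist v i j.
  rewrite [X in _ = _ + X](exchange_big_dep predT)//= -big_split; apply: eq_bigr => i _ /=.
  rewrite (bigID (fun j : 'I_n => (i < j)%N)) /=; congr (_ + _).
  rewrite (bigID (fun j : 'I_n => (j < i)%N)) /= [X in _ + X]big1 ?addr0.
    apply: eq_big => [j|j _]; last by rewrite sqdistC.
    by case: ltngtP.
  move=> j; rewrite -!leqNgt => /andP[ji ij].
  have -> : j = i by apply/val_inj/eqP; rewrite eqn_leq ji ij.
  by rewrite sqdistxx mulr0.
rewrite -big_split mulr_sumr; apply: eq_bigr => i _ /=.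
rewrite -big_split mulr_sumr; apply: eq_bigr => j _ /=.
by ring.
Qed.

(** Keeps the set of objective values nonempty, so that [sup] does not fall back on its default. *)
Lemma flow_feasible0 : flow_feasible Hd Tl w (fun _ _ => 0).
Proof.
exists (fun _ _ _ => 0); split=> //.
- by move=> i j; rewrite big1.
- by move=> e; rewrite big1 => [|i _]; [exact/ltW|rewrite big1].
Qed.

(** Arbitrary [A] and [B] let this serve both for cuts and for single entries of the flow. *)
Lemma flow_edge_le Fe : (forall e i j, i \in Hd e -> j \in Tl e -> 0 <= Fe e i j) ->
  (forall e, \sum_(i in Hd e) \sum_(j in Tl e) Fe e i j <= w e) ->
  forall e (A B : pred 'I_n),
    \sum_(i in Hd e | A i) \sum_(j in Tl e | B j) Fe e i j <= w e.
Proof.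
move=> Fe0 Few e A B; apply: le_trans (Few e).
rewrite [leRHS](bigID A) /= -[leLHS]addr0 lerD//; last first.
  by apply: sumr_ge0 => i /andP[iH _]; apply: sumr_ge0 => j; exact: Fe0.
apply: ler_sum => i /andP[iH _].
rewrite [leRHS](bigID B) /= lerDl.
by apply: sumr_ge0 => j /andP[jT _]; exact: Fe0.
Qed.

(** Flow runs from the tail index [j] to the head index [i], so only hyperedges leaving [S] carry it
    out of [S]. *)
Lemma flow_across_le (F : 'I_n -> 'I_n -> R) (S : {set 'I_n}) : flow_feasible Hd Tl w F ->
  \sum_(i | i \notin S) \sum_(j in S) F i j <= wout Hd Tl w S.
Proof.
move=> [Fe [Fe0 FE Few _]].
have -> : \sum_(i | i \notin S) \sum_(j in S) F i j =
   \sum_e \sum_(i in Hd e | i \notin S) \sum_(j in Tl e | j \in S) Fe e i j.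
  under eq_bigr do under eq_bigr do rewrite FE big_mkcond.
  under eq_bigr do rewrite exchange_big.
  rewrite exchange_big; apply: eq_bigr => e _ /=.
  rewrite [RHS]big_mkcond [LHS]big_mkcond; apply: eq_bigr => i _ /=.
  case: (i \in S) => /=; first by rewrite andbF.
  rewrite andbT; case: (i \in Hd e) => /=; last by rewrite big1.
  by rewrite -big_mkcondr; apply: eq_bigl => j; rewrite andbC.
rewrite /wout [leRHS]big_mkcond; apply: ler_sum => e _.
case: ifP => [_|]; first exact: flow_edge_le.
move/negbT; rewrite negb_and !negbK => /orP[/eqP TS|/eqP HS].
  rewrite big1// => i _; rewrite big_pred0// => j; apply/negP => h.
  by have := finset.in_set0 j; rewrite -TS inE h.
rewrite big_pred0// => i; apply/negP => h.
by have := finset.in_set0 i; rewrite -HS !inE h.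
Qed.

Lemma flow_across_eq (F : 'I_n -> 'I_n -> R) (S : {set 'I_n}) : flow_feasible Hd Tl w F ->
  \sum_(i | i \notin S) \sum_(j in S) F i j = \sum_(i in S) \sum_(j | j \notin S) F i j.
Proof.
move=> [Fe [_ _ _ circ]].
have : \sum_(j in S) \sum_i F i j = \sum_(j in S) \sum_k F j k by apply: eq_bigr.
under eq_bigr do rewrite (bigID (mem S)) /=.
under [RHS]eq_bigr do rewrite (bigID (mem S)) /=.
rewrite !big_split /= exchange_big /= => /addrI h.
by rewrite exchange_big.
Qed.

(** A crude bound, which makes the set of objective values bounded above. *)
Lemma flow_le (F : 'I_n -> 'I_n -> R) i j : flow_feasible Hd Tl w F -> F i j <= \sum_e w e.
Proof.
move=> [Fe [Fe0 FE Few _]]; rewrite FE big_mkcond; apply: ler_sum => e _.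
case: ifP => [/andP[iH jT]|_]; last exact/ltW.
have := flow_edge_le Fe Fe0 Few e (pred1 i) (pred1 j).
rewrite (big_pred1 i) => [|k]; last by rewrite /=; case: eqP => [->|]; rewrite ?iH ?andbF.
by rewrite (big_pred1 j) => [//|k]; rewrite /=; case: eqP => [->|]; rewrite ?jT ?andbF.
Qed.

Lemma sdp_obj_le_val v F : flow_feasible Hd Tl w F -> sdp_obj v F <= sdp_val Hd Tl w v.
Proof.
move=> hF; apply: ub_le_sup; last by exists F.
exists (2^-1 * \sum_i \sum_j (\sum_e w e) * sqdist v i j) => _ [G [hG ->]].
rewrite sdp_objE ler_pM2l ?invr_gt0//; apply: ler_sum => i _; apply: ler_sum => j _.
by rewrite ler_wpM2r ?sqdist_ge0// flow_le.
Qed.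

Lemma sdp_val_le v (B : R) : (forall F, flow_feasible Hd Tl w F -> sdp_obj v F <= B) ->
  sdp_val Hd Tl w v <= B.
Proof.
move=> hB; apply: ge_sup; last by move=> _ [F [hF ->]]; exact: hB.
by exists (sdp_obj v (fun _ _ => 0)), (fun _ _ => 0); split=> //; exact: flow_feasible0.
Qed.

Lemma sdp_val_ge0 v : 0 <= sdp_val Hd Tl w v.
Proof.
apply: le_trans (sdp_obj_le_val v _ flow_feasible0).
by rewrite sdp_objE big1 ?mulr0// => i _; rewrite big1// => j _; rewrite mul0r.
Qed.

End SdpValue.

(** * The two inequalities *)

Section Main.
Context {R : realType} {n : nat} {E : finType}.
Variables (Hd Tl : E -> {set 'I_n}) (w : E -> R) (pi : 'I_n -> R).
Hypothesis n2 : (2 <= n)%N.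
Hypothesis w0 : forall e, 0 < w e.
Hypothesis pi0 : forall i, 0 < pi i.

Lemma lambdaDelta_le_val v : sdp_feasible pi v ->
  lambdaDelta Hd Tl w pi <= sdp_val Hd Tl w v.
Proof.
move=> hv; apply: ge_inf; last by exists v.
by exists 0 => _ [u [_ ->]]; exact: sdp_val_ge0.
Qed.

(** Put [S] at [b] and its complement at [- a] on a line. After normalisation the squared distance
    across the cut is [a^-1 + b^-1], at most twice the inverse of the smaller measure. By
    conservation the flow is the same in both directions, hence bounded by the smaller cut
    weight. *)
Lemma cut_embedding (S : {set 'I_n}) : S != finset.set0 -> S != finset.setTfor 'I_n ->
  exists v, sdp_feasible pi v /\ sdp_val Hd Tl w v <= 2 * dphiS Hd Tl w pi S.
Proof.
move=> S0 ST.
have a0 : 0 < piS pi S by exact: piS_gt0.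
have b0 : 0 < piS pi (~: S) by apply: piS_gt0 => //; rewrite setC_eq0.
set a := piS pi S in a0; set b := piS pi (~: S) in b0.
have bE : b = \sum_(i | i \notin S) pi i by apply: eq_bigl => i; rewrite inE.
(* Normalises the total: [a * b ^+ 2 + b * a ^+ 2] is [a * b * (a + b)]. *)
pose kap := (Num.sqrt (a * b * (a + b)))^-1.
have kap2 : kap ^+ 2 = (a * b * (a + b))^-1.
  by rewrite exprVn sqr_sqrtr// ltW// !mulr_gt0// addr_gt0.
pose x i := kap * (if i \in S then b else - a).
pose k0 : 'I_n := Ordinal (ltnW n2).
pose v (i k : 'I_n) := if k == k0 then x i else 0.
have sumk (F : 'I_n -> R) : (forall k, k != k0 -> F k = 0) -> \sum_k F k = F k0.
  by move=> F0; rewrite (bigD1 k0)//= big1 ?addr0.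
have dE i j : sqdist v i j = (a + b) / (a * b) * ((i \in S) != (j \in S))%:R.
  rewrite /sqdist sumk => [|k /negbTE kk]; last by rewrite /v kk subrr expr0n.
  rewrite /v eqxx /x -mulrBr exprMn kap2.
  have a0' : a != 0 by rewrite gt_eqF.
  have b0' : b != 0 by rewrite gt_eqF.
  have ab0' : a + b != 0 by rewrite gt_eqF// addr_gt0.
  case: (i \in S); case: (j \in S) => /=; rewrite ?subrr ?expr0n ?mulr0//= ?mulr1 ?mulr0;
    field; by rewrite a0' b0' ab0'.
have D0 : 0 <= (a + b) / (a * b) by rewrite divr_ge0// ltW// ?addr_gt0// mulr_gt0.
exists v; split.
  split.
  - move=> k; have [->|kk] := eqVneq k k0; last by rewrite big1// => i _; rewrite /v (negbTE kk) mulr0.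
    under eq_bigr do rewrite /v eqxx /x mulrCA.
    rewrite -mulr_sumr (bigID (mem S)) /=.
    rewrite (eq_bigr (fun i => pi i * b)) => [|i ->//].
    rewrite [X in _ * (_ + X)](eq_bigr (fun i => pi i * - a)) => [|i /negbTE ->//].
    by rewrite -!mulr_suml -bE -/(piS pi S) -/a; ring.
  - have -> : \sum_i pi i * sqnorm v i = kap ^+ 2 * \sum_i pi i * (if i \in S then b else - a) ^+ 2.
      rewrite mulr_sumr; apply: eq_bigr => i _.
      rewrite /sqnorm sumk => [|k /negbTE kk]; last by rewrite /v kk expr0n.
      by rewrite /v eqxx /x exprMn mulrCA.
    rewrite (bigID (mem S)) /=.
    rewrite (eq_bigr (fun i => pi i * b ^+ 2)) => [|i ->//].
    rewrite [X in _ * (_ + X)](eq_bigr (fun i => pi i * (- a) ^+ 2)) => [|i /negbTE ->//].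
    rewrite -!mulr_suml -bE -/(piS pi S) -/a kap2.
    by field; rewrite !gt_eqF// addr_gt0.
  move=> i j k; rewrite !dE -mulrDr ler_wpM2l// -natrD ler_nat.
  by case: (i \in S); case: (j \in S); case: (k \in S).
apply: sdp_val_le => // F hF.
set X := \sum_(i | i \notin S) \sum_(j in S) F i j.
have obj : sdp_obj v F = (a + b) / (a * b) * X.
  rewrite sdp_objE.
  under eq_bigr do under eq_bigr do rewrite dE mulrCA.
  under eq_bigr do rewrite -mulr_sumr.
  rewrite -mulr_sumr (bigID (mem S)) /=.
  rewrite (eq_bigr (fun i => \sum_(j | j \notin S) F i j)) => [|i iS]; last first.
    rewrite [RHS]big_mkcond; apply: eq_bigr => j _; rewrite iS.
    by case: (j \in S); rewrite /= ?mulr0 ?mulr1.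
  rewrite [X in _ * (_ * (_ + X))](eq_bigr (fun i => \sum_(j in S) F i j)) => [|i /negbTE iS]; last first.
    rewrite [RHS]big_mkcond; apply: eq_bigr => j _; rewrite iS.
    by case: (j \in S); rewrite /= ?mulr0 ?mulr1.
  by rewrite -(flow_across_eq Hd Tl w F S hF) -/X; field; rewrite !gt_eqF.
have X1 : X <= Num.min (wout Hd Tl w S) (wout Hd Tl w (~: S)).
  rewrite le_min flow_across_le//= /X (flow_across_eq Hd Tl w F S hF).
  have := flow_across_le Hd Tl w F (~: S) hF.
  rewrite (eq_bigl (mem S)) => [|i]; last by rewrite inE negbK.
  by under eq_bigr do under eq_bigl do rewrite inE.
rewrite obj /dphiS -/a -/b.
set m := Num.min (wout _ _ _ _) _ in X1 *.
have m0 : 0 <= m by rewrite le_min !wout_ge0.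
apply: le_trans (ler_wpM2l D0 X1) _.
rewrite mulrCA mulrC ler_wpM2l//.
have -> : (a + b) / (a * b) = a^-1 + b^-1 by field; rewrite !gt_eqF.
have c0 : 0 < Num.min a b by rewrite lt_min a0.
have h1 : a^-1 <= (Num.min a b)^-1 by rewrite lef_pV2 ?posrE// ge_min lexx.
have h2 : b^-1 <= (Num.min a b)^-1 by rewrite lef_pV2 ?posrE// ge_min lexx orbT.
lra.
Qed.

Lemma nontrivial_cut : exists S : {set 'I_n}, S != finset.set0 /\ S != finset.setTfor 'I_n.
Proof.
pose i0 : 'I_n := Ordinal (ltnW n2); pose i1 : 'I_n := Ordinal n2.
exists [set i0]; split; first by apply/set0Pn; exists i0; rewrite inE.
by apply/eqP => /setP/(_ i1); rewrite !inE.
Qed.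

Lemma lambdaDelta_le_dphi : lambdaDelta Hd Tl w pi <= 2 * dphi Hd Tl w pi.
Proof.
suff : lambdaDelta Hd Tl w pi / 2 <= dphi Hd Tl w pi by lra.
have [S [S0 ST]] := nontrivial_cut.
apply: lb_le_inf; first by exists (dphiS Hd Tl w pi S), S.
move=> _ [T [T0 TT ->]]; have [v [hv vT]] := cut_embedding T T0 TT.
by have := lambdaDelta_le_val v hv; lra.
Qed.

(** Expanding the squares, the inner products cancel because the vectors are centred. *)
Lemma sum_sqdist v : sdp_feasible pi v ->
  \sum_i \sum_j pi i * pi j * sqdist v i j = 2 * \sum_i pi i.
Proof.
move=> [hc hn _].
have E1 i j : sqdist v i j = sqnorm v i + sqnorm v j + \sum_k (- 2 * v i k) * v j k.
  by rewrite -!big_split; apply: eq_bigr => k _ /=; ring.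
have E2 i : \sum_j pi i * pi j * sqdist v i j = pi i * sqnorm v i * (\sum_j pi j) + pi i.
  rewrite [X in _ = _ + X](_ : _ = pi i * (\sum_j pi j * sqnorm v j) +
     \sum_k (- 2 * pi i * v i k) * \sum_j pi j * v j k); last first.
    by rewrite hn mulr1 big1 ?addr0// => k _; rewrite hc mulr0.
  rewrite mulr_sumr mulr_sumr.
  under [X in _ + (_ + X)]eq_bigr do rewrite mulr_sumr.
  rewrite [X in _ + (_ + X)]exchange_big -!big_split; apply: eq_bigr => j _ /=.
  rewrite E1 mulrDr mulr_sumr addrA; congr (_ + _); first by ring.
  by apply: eq_bigr => k _; ring.
under eq_bigr do rewrite E2.
by rewrite big_split /= -mulr_suml hn; ring.
Qed.

Lemma dphi_le_val v : sdp_feasible pi v ->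
  dphi Hd Tl w pi <=
  640 * (160 * 2000 ^+ 3) * Num.sqrt (ln n%:R) * sdp_val Hd Tl w v.
Proof.
move=> hv; have [_ _ tri] := hv.
set P := \sum_i pi i.
have P0 : 0 < P.
  by rewrite /P (bigD1 (Ordinal n2))//=; apply: ltr_wpDr => //; apply: sumr_ge0 => j _; exact/ltW.
(* The factor compensates for normalising [pi] to a probability, making the mean squared distance
   exactly 2; coordinates from [n] on are 0. *)
pose vec (i : 'I_n) k := Num.sqrt P * oapp (v i) 0 (insub k : option 'I_n).
have sqdE i j : sqd n vec i j = P * sqdist v i j.
  rewrite mulr_sumr; apply: eq_bigr => k _.
  rewrite /vec valK /= -mulrBr exprMn sqr_sqrtr//.
  exact: ltW.
have vtri i j k : sqd n vec i k <= sqd n vec i j + sqd n vec j k.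
  by rewrite !sqdE -mulrDr ler_pM2l.
have p0 i : 0 <= pi i / P by rewrite divr_ge0// ltW.
have p1 : \sum_i pi i / P = 1 by rewrite -mulr_suml divff// gt_eqF.
have spread : 2 <= \sum_i \sum_j (pi i / P) * (pi j / P) * sqd n vec i j.
  rewrite [leRHS](_ : _ = P^-1 * \sum_i \sum_j pi i * pi j * sqdist v i j).
    by rewrite sum_sqdist// -/P mulrCA mulVf ?mulr1// gt_eqF.
  rewrite mulr_sumr; apply: eq_bigr => i _; rewrite mulr_sumr; apply: eq_bigr => j _.
  by rewrite sqdE; field; rewrite gt_eqF.
have nV : (2 <= #|'I_n|)%N by rewrite card_ord.
have := arv_frechet n vec (fun i => pi i / P) p0 p1 vtri nV spread.
rewrite card_ord; set C := 160 * 2000 ^+ 3; set l := Num.sqrt _.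
move=> [L [h [hL h0 hd hs]]].
have [q [r [q0 dq wq]]] := flow_duality Hd Tl w (sqdist v) (2 * sdp_val Hd Tl w v)
  ltac:(by move=> F /(sdp_obj_le_val Hd Tl w w0 v); rewrite sdp_objE; lra).
have L0 : L != finset.set0.
  by apply/eqP => L0; move: hL; rewrite L0 big_set0; lra.
have cL : 1 / 80 * (\sum_i pi i) <= piS pi L.
  by move: hL; rewrite -mulr_suml -/P ler_pdivlMr.
have := @dphi_frechet R n E Hd Tl w pi w0 pi0 (sqdist v) q r (fun i => h i / P) L (1 / 80)
  (sqdistxx v) (sqdistC v) tri q0 dq.
move=> /(_ (fun i => divr_ge0 (h0 i) (ltW P0))).
have hd' i j : i \in L -> h j / P <= sqdist v i j.
  by move=> iL; rewrite ler_pdivrMr// mulrC -sqdE hd.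
move=> /(_ hd' L0 ltac:(lra) ltac:(lra) cL).
have -> : \sum_i pi i * (h i / P) = \sum_i pi i / P * h i.
  by apply: eq_bigr => i _; rewrite mulrCA mulrC.
move: hs; set s := \sum_i _ => hs hphi.
have phi0 : 0 <= dphi Hd Tl w pi by exact: dphi_ge0.
have Cl : 0 <= C * l by rewrite mulr_ge0 ?sqrtr_ge0// mulr_ge0// exprn_ge0.
(* 640 is 80 for the measure of [L], times 4 from the two sweeps, times 2 from the factor 1/2 in the
   objective. *)
have h1 : dphi Hd Tl w pi <= dphi Hd Tl w pi * (C * l * s) by rewrite ler_peMr.
have h2 : C * l * (dphi Hd Tl w pi * (1 / 80) * s) <= C * l * (8 * sdp_val Hd Tl w v).
  by rewrite ler_wpM2l//; lra.
apply: le_trans h1 _.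
rewrite (_ : _ * (C * l * s) = 80 * (C * l * (dphi Hd Tl w pi * (1 / 80) * s))); last by field.
rewrite (_ : 640 * C * l * _ = 80 * (C * l * (8 * sdp_val Hd Tl w v))); last by ring.
by rewrite ler_pM2l.
Qed.

Lemma dphi_le_lambdaDelta :
  dphi Hd Tl w pi <=
  640 * (160 * 2000 ^+ 3) * Num.sqrt (ln n%:R) * lambdaDelta Hd Tl w pi.
Proof.
set c := _ * Num.sqrt _.
have c0 : 0 < c.
  rewrite /c !mulr_gt0// ?exprn_gt0// sqrtr_gt0 ln_gt0// ltr1n//.
rewrite mulrC -ler_pdivrMr//.
have [S [S0 ST]] := nontrivial_cut.
(* Any cut shows that the program is feasible, so the infimum is over a nonempty set. *)
have [v [hv _]] := cut_embedding S S0 ST.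
apply: lb_le_inf; first by exists (sdp_val Hd Tl w v), v.
by move=> _ [u [hu ->]]; rewrite ler_pdivrMr// mulrC; exact: dphi_le_val.
Qed.

End Main.

Theorem mainTheorem19 :
  exists C1 C2 : nat, (0 < C1)%N /\ (0 < C2)%N /\
  forall (R : realType) (n : nat) (E : finType)
         (Hd Tl : E -> {set 'I_n}) (w : E -> R) (pi : 'I_n -> R),
    (2 <= n)%N ->
    (forall e, 0 < w e) ->
    (forall i, 0 < pi i) ->
    lambdaDelta Hd Tl w pi <= C1%:R * dphi Hd Tl w pi /\
    dphi Hd Tl w pi <= C2%:R * Num.sqrt (ln (n%:R : R)) * lambdaDelta Hd Tl w pi.
Proof.
exists 2%N, (640 * (160 * 2000 ^ 3))%N; split; first by [].
split; first by rewrite !muln_gt0.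
move=> R n E Hd Tl w pi n2 w0 pi0; split; first exact: lambdaDelta_le_dphi.
by rewrite natrM natrM natrX; exact: dphi_le_lambdaDelta.
Qed.
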